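(* Let $E$ and $F$ be real Banach spaces and $T\colon E\rightarrow F'$ be a (bounded) linear operator. Suppose there exist two Lipschitz functions $f\colon E\rightarrow \ell_{\infty}(B_{E'})$ and $g\colon \ell_{\infty}(B_{E'})\rightarrow F'$, the latter belonging to a maximal Banach Lipschitz operator ideal $\mathcal I$ that is invariant under translations, such that $T=g\circ f$. Then there exist linear operators $S\in\mathcal L(E, \ell_{\infty}(B_{E'}))$ and $R\in \mathcal I\cap \mathcal L(\ell_{\infty}(B_{E'}), F')$ such that $T=R\circ S$ and $\|R\|_{\mathcal I} \|S\|\leq \mathrm{Lip}(f) \|g\|_{\mathcal I}$.
   Context: All Banach spaces are real. $E'$ denotes the (topological) dual of $E$, $B_{E'}$ its open unit ball, $\ell_\infty(B_{E'})$ the Banach space of bounded real functions on the set $B_{E'}$ with the supremum norm, and $\mathcal L(E,F)$ is the space of bounded linear operators from $E$ to $F$. Pointed metric spaces have distinguished point denoted $0$; every Banach space is a pointed metric space with distinguished point $0$, and a subset containing $0$ is a pointed metric space with the same distinguished point. For pointed metric spaces $X,Y$, $\mathrm{Lip}_0(X,Y)$ is the set of Lipschitz maps $f\colon X\to Y$ with $f(0)=0$; $\mathrm{Lip}(f)$ is the least Lipschitz constant of a Lipschitz map $f$. Banach Lipschitz operator ideal: a subclass $\mathcal I$ of $\mathrm{Lip}_0$ together with a function $\|\cdot\|_{\mathcal I}\colon \mathcal I\to[0,\infty)$ such that, writing $\mathcal I(X,E)=\mathrm{Lip}_0(X,E)\cap\mathcal I$ for a pointed metric space $X$ and a Banach space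 $E$: (i) $\mathcal I(X,E)$ is a linear subspace of $\mathrm{Lip}_0(X,E)$, $(\mathcal I(X,E),\|\cdot\|_{\mathcal I})$ is a Banach space, and $\mathrm{Lip}(f)\le\|f\|_{\mathcal I}$ for all $f\in\mathcal I(X,E)$; (ii) $Id_{\mathbb R}\in\mathcal I(\mathbb R,\mathbb R)$ and $\|Id_{\mathbb R}\|_{\mathcal I}=1$; (iii) if $g\in\mathrm{Lip}_0(Y,X)$, $f\in\mathcal I(X,E)$ and $S\in\mathcal L(E,F)$, then $S\circ f\circ g\in\mathcal I(Y,F)$ and $\|S\circ f\circ g\|_{\mathcal I}\le \mathrm{Lip}(g)\,\|f\|_{\mathcal I}\,\|S\|$. $\mathcal I\cap\mathcal L$ denotes the class of bounded linear operators between Banach spaces that belong to $\mathcal I$, with the norm $\|\cdot\|_{\mathcal I}$; its components are $\mathcal I\cap\mathcal L(E,F)$. It is a Banach (linear) operator ideal. Maximal hull: $f\in \mathrm{Lip}_0(X,E)$ belongs to $\mathcal I^{\max}(X,E)$ if $\|f\|_{\mathcal I^{\max}}:=\sup\|Q\circ f\circ\iota\|_{\mathcal I(X_0,E/M)}<\infty$, the supremum being over all finite metric subspaces $X_0\subset X$ (containing $0$) and all (closed) cofinite-dimensional subspaces $M$ of $E$, where $\iota\colon X_0\to X$ is the inclusion and $Q\colon E\to E/M$ the quotient map. $\mathcal I$ is maximal if $\mathcal I=\mathcal I^{\max}$ with equal norms. Translations: for $X\subset E$ with $0\in X$, $x_0\in X$ and $f\colon X\to F$, put $X-x_0=\{x-x_0\colon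 x\in X\}$ and $f^{x_0}\colon X-x_0\to F$, $f^{x_0}(z)=f(z+x_0)-f(x_0)$. $\mathcal I$ is invariant under translations if for all Banach spaces $E,F$, every subset $X\subset E$ with $0\in X$, every $x_0\in X$ and every Lipschitz map $f\colon X\to F$ with $f(0)=0$, one has $f\in\mathcal I(X,F)$ if and only if $f^{x_0}\in\mathcal I(X-x_0,F)$, with $\|f\|_{\mathcal I}=\|f^{x_0}\|_{\mathcal I}$. *)

(* Defs.v *)
From HB Require Import structures.
From mathcomp Require Import all_boot all_order all_algebra generic_quotient.
From mathcomp Require Import all_classical all_reals all_analysis.

Set Implicit Arguments.
Unset Strict Implicit.
Unset Printing Implicit Defensive.

Import Order.TTheory GRing.Theory Num.Theory.
Import numFieldNormedType.Exports.
Import Quotient.Exports.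

Local Open Scope classical_set_scope.
Local Open Scope ring_scope.

(* The distinguished point is [point]. *)
#[short(type="pmetricType")]
HB.structure Definition PointedMetric (R : numDomainType) :=
  {M of Metric R M & isPointed M}.

(* The library provides no metric structure on normed spaces other than the
   scalars, and does not require the [point] of a normed space to be 0: this
   alias of [E] carries the norm metric, with 0 as distinguished point. *)
Definition normed_metric (R : numDomainType) (E : normedModType R) : Type := E.

Section NormedMetric.
Context {R : numDomainType} {E : normedModType R}.

HB.instance Definition _ := PseudoMetric.copy (normed_metric E) E.

Let dist (x y : normed_metric E) : R := `|(x : E) - y|.

Let dist_ge0 x y : 0 <= dist x y. Proof. exact: normr_ge0. Qed.

Let dist_positivity x y : dist x y = 0 -> x = y.
Proof. by move/normr0_eq0/eqP; rewrite subr_eq0 => /eqP. Qed.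

Let ball_dist x d : ball x d = [set y | dist x y < d].
Proof. by rewrite -[LHS]/(@ball R E x d) -ball_normE. Qed.

HB.instance Definition _ := @PseudoMetric_isMetric.Build R (normed_metric E)
  dist dist_ge0 dist_positivity ball_dist.

HB.instance Definition _ := isPointed.Build (normed_metric E) (0 : E).

End NormedMetric.

(* The pointed metric subspace carried by [A]. *)
Definition metric_sub (R : realType) (X : pmetricType R) (A : set X)
  (A0 : A point) : Type := set_type A.

Section MetricSub.
Context {R : realType} {X : pmetricType R} {A : set X} (A0 : A point).

HB.instance Definition _ := PseudoMetric.copy (metric_sub A0) (set_type A).

Let dist (x y : metric_sub A0) : R := mdist (val x) (val y).

Let dist_ge0 x y : 0 <= dist x y. Proof. exact: mdist_ge0. Qed.

Let dist_positivity x y : dist x y = 0 -> x = y.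
Proof. by move/mdist_positivity/val_inj. Qed.

Let ball_dist x d : ball x d = [set y | dist x y < d].
Proof.
by apply/seteqP; split => y; rewrite -[ball x d y]/(ball (val x) d (val y))
  ballEmdist.
Qed.

HB.instance Definition _ := @PseudoMetric_isMetric.Build R (metric_sub A0)
  dist dist_ge0 dist_positivity ball_dist.

HB.instance Definition _ :=
  isPointed.Build (metric_sub A0) (exist _ point (mem_set A0)).

End MetricSub.

Definition incl (R : realType) (X : pmetricType R) (A : set X) (A0 : A point)
  (x : metric_sub A0) : X := val x.

Section Lipschitz.
Context {R : realType}.

Definition lip_bound (X Y : metricType R) (f : X -> Y) : set R :=
  [set k | 0 <= k /\ forall x y, mdist (f x) (f y) <= k * mdist x y].

Definition is_lipschitz (X Y : metricType R) (f : X -> Y) : Prop :=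
  lip_bound f !=set0.

Definition Lip (X Y : metricType R) (f : X -> Y) : R := inf (lip_bound f).

Definition Lip0 (X Y : pmetricType R) : set (X -> Y) :=
  [set f | is_lipschitz f /\ f point = point].

End Lipschitz.

(* Completeness of a space of functions normed by the best constant in
   |f x| <= c x * M, for evaluation [ev] and weight [c]; used below with
   [c x = |x|] (operators) and [c x = 1] (bounded functions). *)
Lemma weighted_complete (R : realType) (V : normedModType R)
    (W : completeNormedModType R) (S : Type) (ev : V -> S -> W) (c : S -> R) :
  (forall x, 0 <= c x) ->
  (forall f g x, ev (f - g) x = ev f x - ev g x) ->
  (forall f x, `|ev f x| <= c x * `|f|) ->
  (forall f (M : R), 0 <= M -> (forall x, `|ev f x| <= c x * M) -> `|f| <= M) ->
  (forall g : S -> W, (forall e : R, 0 < e -> exists f, forall x,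
     `|g x - ev f x| <= c x * e) -> exists h, ev h = g) ->
  forall F : set_system V, ProperFilter F -> cauchy F -> cvg F.
Proof.
move=> c0 evB ev_le norm_le ev_lim F FF /cauchyP Fc.
have Fex (e : R) : 0 < e -> exists2 A, F A &
    forall f g, A f -> A g -> `|f - g| <= e.
  move=> e0; have [|f0 Ff0] := Fc (e / 2); first by rewrite divr_gt0.
  exists (ball f0 (e / 2)) => // f g.
  rewrite -ball_normE /= => fA gA.
  rewrite -[f - g](subrKA f0) (le_trans (ler_normD _ _))// [e]splitr.
  by rewrite lerD// ltW// distrC.
have Fx x : cvg ((ev ^~ x) @ F).
  apply: cauchy_cvg; apply/cauchy_ballP => e e0.
  have e'0 : 0 < e / (c x + 1) by rewrite divr_gt0// ltr_wpDl.
  have [A FA Ae] := Fex _ e'0.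
  have FxA : F [set f | (ev ^~ x @` A) (ev f x)].
    by apply: (filterS _ FA) => f Af; exists f.
  exists (ev ^~ x @` A, ev ^~ x @` A) => //=.
  move=> [_ _] [/= [f Af <-] [g Ag <-]].
  rewrite -ball_normE/= -evB (le_lt_trans (ev_le _ _))//.
  rewrite (le_lt_trans (ler_wpM2l (c0 x) (Ae _ _ Af Ag)))//.
  by rewrite mulrCA gtr_pMr// ltr_pdivrMr ?mul1r ?ltrDl// ltr_wpDl.
pose g x := lim ((ev ^~ x) @ F).
have gA (e : R) : 0 < e -> exists2 A, F A &
    forall f, A f -> forall x, `|g x - ev f x| <= c x * e.
  move=> e0; have [A FA Ae] := Fex _ e0; exists A => // f Af x.
  apply/ler_addgt0Pl => d d0.
  have /cvgrPdist_le/(_ _ d0) FB := Fx x.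
  have [h [Ah Bh]] : (A `&` [set f | `|g x - ev f x| <= d]) !=set0.
    by apply: (@filter_ex _ F); apply: filterI.
  rewrite -[_ - ev f x](subrKA (ev h x)) (le_trans (ler_normD _ _))//.
  by rewrite lerD// -evB (le_trans (ev_le _ _))// ler_wpM2l// Ae.
have [|h hg] := ev_lim g.
  move=> e /gA[A FA Ae]; have [f Af] := filter_ex FA.
  by exists f; exact: Ae.
apply: (cvgP h); apply/(@cvgrPdist_le _ _ _ F _ id) => e e0.
have [A FA Ae] := gA _ e0; apply: filterS FA => f Af.
apply: norm_le => [|x]; first exact: ltW.
by rewrite evB hg; exact: Ae.
Qed.

Definition bounded_linear (R : realType) (E F : normedModType R)
    (f : E -> F) : bool :=
  `[< linear f /\ exists k, forall x, `|f x| <= k * `|x| >].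

(* The space of bounded linear operators. *)
Record blin (R : realType) (E F : normedModType R) :=
  BLin { blin_fun :> E -> F; _ : bounded_linear blin_fun }.

Section BLin.
Context {R : realType} {E F : normedModType R}.

HB.instance Definition _ := [isSub for @blin_fun R E F].
HB.instance Definition _ := [Choice of blin E F by <:].

Lemma bounded_linear_submod : submod_closed (@bounded_linear R E F).
Proof.
split.
  apply/asboolP; split.
    by move=> a x y; rewrite -[RHS]/(a *: (0 : F) + 0) scaler0 addr0.
  by exists 0 => x; rewrite normr0 mul0r.
move=> a f g /asboolP[fl [k fk]] /asboolP[gl [l gl']]; apply/asboolP; split.
  move=> b x y; rewrite !fctE /= fl gl !scalerDr !scalerA (mulrC b).
  by rewrite addrACA.
exists (`|a| * k + l) => x; rewrite (le_trans (ler_normD _ _))// mulrDl.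
by rewrite lerD// normrZ -mulrA ler_wpM2l.
Qed.

HB.instance Definition _ := GRing.isSubmodClosed.Build R (E -> F)
  (@bounded_linear R E F) bounded_linear_submod.
HB.instance Definition _ := [SubChoice_isSubLmodule of blin E F by <:].

Lemma blin_linear (f : blin E F) : linear f.
Proof. by have /asboolP[] := valP f. Qed.

HB.instance Definition _ (f : blin E F) :=
  GRing.isLinear.Build R E F _ (blin_fun f) (blin_linear f).

Lemma blin_bounded (f : blin E F) : exists k, forall x, `|f x| <= k * `|x|.
Proof. by have /asboolP[] := valP f. Qed.

Definition opnorm (f : blin E F) : R :=
  sup [set `|f x| | x in [set x | `|x| <= 1]].

Lemma opnorm_has_sup (f : blin E F) :
  has_sup [set `|f x| | x in [set x | `|x| <= 1]].
Proof.
split; first by exists `|f 0|; exists 0 => //=; rewrite normr0.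
have [k fk] := blin_bounded f; exists `|k| => _ [x /= x1 <-].
rewrite (le_trans (fk x))// (le_trans (ler_norm _))// normrM normr_id.
by rewrite ler_piMr.
Qed.

Lemma opnorm_ge0 f : 0 <= opnorm f.
Proof.
apply: (ub_le_sup (opnorm_has_sup f).2); exists 0; first by rewrite /= normr0.
by rewrite linear0 normr0.
Qed.

Lemma opnorm_ub (f : blin E F) x : `|f x| <= opnorm f * `|x|.
Proof.
have [->|x0] := eqVneq x 0; first by rewrite linear0 !normr0 mulr0.
have xgt0 : 0 < `|x| by rewrite normr_gt0.
rewrite -ler_pdivrMr//; apply: (ub_le_sup (opnorm_has_sup f).2).
exists (`|x|^-1 *: x); first by rewrite /= normfZV.
by rewrite linearZ normrZ ger0_norm ?invr_ge0// mulrC.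
Qed.

Lemma opnorm_le (f : blin E F) M : 0 <= M -> (forall x, `|f x| <= `|x| * M) ->
  opnorm f <= M.
Proof.
move=> M0 fM; apply: ge_sup; first exact: (opnorm_has_sup f).1.
by move=> _ [x /= x1 <-]; rewrite (le_trans (fM x))// ler_piMl.
Qed.

Let opnormD f g : opnorm (f + g) <= opnorm f + opnorm g.
Proof.
apply: opnorm_le => [|x]; first by rewrite addr_ge0// opnorm_ge0.
rewrite (le_trans (ler_normD _ _))// mulrC mulrDl.
by rewrite lerD// opnorm_ub.
Qed.

Let opnormZ_le a f : opnorm (a *: f) <= `|a| * opnorm f.
Proof.
apply: opnorm_le => [|x]; first by rewrite mulr_ge0// opnorm_ge0.
by rewrite normrZ mulrCA ler_wpM2l// mulrC opnorm_ub.
Qed.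

Let opnormZ a f : opnorm (a *: f) = `|a| * opnorm f.
Proof.
apply/eqP; rewrite eq_le opnormZ_le/=.
have [->|a0] := eqVneq a 0; first by rewrite normr0 mul0r opnorm_ge0.
rewrite -ler_pdivlMl ?normr_gt0// -normfV (le_trans _ (opnormZ_le _ _))//.
by rewrite scalerA mulVf// scale1r.
Qed.

Let opnorm_eq0 f : opnorm f = 0 -> f = 0.
Proof.
move=> f0; apply/val_inj/funext => x.
by apply/eqP; rewrite -normr_le0 (le_trans (opnorm_ub f x))// f0 mul0r.
Qed.

HB.instance Definition _ := @Lmodule_isNormed.Build R (blin E F) opnorm
  opnormD opnormZ opnorm_eq0.

End BLin.

Section BLinComplete.
Context {R : realType} {E : normedModType R} {F : completeNormedModType R}.

Let blin_complete (A : set_system (blin E F)) :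
  ProperFilter A -> cauchy A -> cvg A.
Proof.
apply: (@weighted_complete R _ F E (@blin_fun R E F) Num.norm) => //.
- by move=> f x; rewrite mulrC; exact: opnorm_ub.
- by move=> f M; exact: opnorm_le.
move=> g g_lim; suff /asboolP gl : linear g /\ exists k, forall x,
    `|g x| <= k * `|x| by exists (BLin gl).
split.
  move=> a x y; apply/eqP; rewrite -subr_eq0 -normr_le0.
  apply/ler_addgt0Pl => e e0; rewrite addr0.
  pose d := `|a *: x + y| + (`|a| * `|x| + `|y|).
  have d0 : 0 <= d by rewrite !addr_ge0// mulr_ge0.
  have e'0 : 0 < e / (d + 1) by rewrite divr_gt0// ltr_wpDl.
  have [f fg] := g_lim _ e'0.
  have -> : g (a *: x + y) - (a *: g x + g y) =
      (g (a *: x + y) - f (a *: x + y)) - (a *: (g x - f x) + (g y - f y)).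
    by rewrite blin_linear scalerBr [in RHS]addrACA -opprD opprB addrA subrK.
  rewrite (@le_trans _ _ (d * (e / (d + 1))))//; last first.
    by rewrite mulrCA ger_pMr// ler_pdivrMr ?mul1r ?lerDl// ltr_wpDl.
  rewrite (le_trans (ler_normB _ _))// /d mulrDl lerD// mulrDl.
  by rewrite (le_trans (ler_normD _ _))// lerD// normrZ -mulrA ler_wpM2l.
have [f fg] := g_lim _ ltr01; exists (1 + opnorm f) => x.
rewrite -[g x](subrK (f x)) (le_trans (ler_normD _ _))// mulrDl.
by rewrite lerD ?opnorm_ub// mulrC.
Qed.

HB.instance Definition _ := Uniform_isComplete.Build (blin E F) blin_complete.

End BLinComplete.

Definition dual (R : realType) (E : normedModType R) :
  completeNormedModType R := blin E R.

Definition bounded_function (R : realType) (S : Type) (u : S -> R) : bool :=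
  `[< exists k, forall s, `|u s| <= k >].

(* The space l_infty(S). *)
Record linfty (R : realType) (S : Type) :=
  Linfty { linfty_fun :> S -> R; _ : bounded_function linfty_fun }.

Section Linfty.
Context {R : realType} {S : Type}.

HB.instance Definition _ := [isSub for @linfty_fun R S].
HB.instance Definition _ := [Choice of linfty R S by <:].

Lemma bounded_function_submod :
  submod_closed (@bounded_function R S : {pred S -> R^o}).
Proof.
split; first by apply/asboolP; exists 0 => s; rewrite normr0.
move=> a u v /asboolP[k uk] /asboolP[l vl]; apply/asboolP.
exists (`|a| * k + l) => s; rewrite (le_trans (ler_normD _ _))//.
by rewrite lerD// normrZ ler_wpM2l.
Qed.

HB.instance Definition _ := GRing.isSubmodClosed.Build R (S -> R^o)
  (@bounded_function R S) bounded_function_submod.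
HB.instance Definition _ := [SubChoice_isSubLmodule of linfty R S by <:].

Definition supnorm (u : linfty R S) : R := sup (range (fun s => `|u s|)).

Lemma supnorm_ubound (u : linfty R S) :
  has_ubound (range (fun s => `|u s|)).
Proof. by have /asboolP[k uk] := valP u; exists k => _ [s _ <-]; exact: uk. Qed.

Lemma supnorm_ub (u : linfty R S) s : `|u s| <= supnorm u.
Proof. by apply: (ub_le_sup (supnorm_ubound u)); exists s. Qed.

Lemma supnorm_le (u : linfty R S) M : 0 <= M -> (forall s, `|u s| <= M) ->
  supnorm u <= M.
Proof.
move=> M0 uM; rewrite /supnorm.
have [->|/set0P u0] := eqVneq (range (fun s => `|u s|)) set0.
  by rewrite sup0.
by apply: ge_sup => // _ [s _ <-].
Qed.

Lemma supnorm_ge0 (u : linfty R S) : 0 <= supnorm u.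
Proof.
rewrite /supnorm.
have [->|/set0P[_ [s _ _]]] := eqVneq (range (fun s => `|u s|)) set0.
  by rewrite sup0.
exact: le_trans (supnorm_ub u s).
Qed.

Let supnormD (u v : linfty R S) : supnorm (u + v) <= supnorm u + supnorm v.
Proof.
apply: supnorm_le => [|s]; first by rewrite addr_ge0// supnorm_ge0.
by rewrite (le_trans (ler_normD _ _))// lerD// supnorm_ub.
Qed.

Let supnormZ_le a (u : linfty R S) : supnorm (a *: u) <= `|a| * supnorm u.
Proof.
apply: supnorm_le => [|s]; first by rewrite mulr_ge0// supnorm_ge0.
by rewrite -[(a *: u) s]/(a * u s) normrM ler_wpM2l// supnorm_ub.
Qed.

Let supnormZ a (u : linfty R S) : supnorm (a *: u) = `|a| * supnorm u.
Proof.
apply/eqP; rewrite eq_le supnormZ_le/=.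
have [->|a0] := eqVneq a 0; first by rewrite normr0 mul0r supnorm_ge0.
rewrite -ler_pdivlMl ?normr_gt0// -normfV (le_trans _ (supnormZ_le _ _))//.
by rewrite scalerA mulVf// scale1r.
Qed.

Let supnorm_eq0 (u : linfty R S) : supnorm u = 0 -> u = 0.
Proof.
move=> u0; apply/val_inj/funext => s.
by apply/eqP; rewrite -normr_le0 (le_trans (supnorm_ub u s))// u0.
Qed.

HB.instance Definition _ := @Lmodule_isNormed.Build R (linfty R S) supnorm
  supnormD supnormZ supnorm_eq0.

Let linfty_complete (A : set_system (linfty R S)) :
  ProperFilter A -> cauchy A -> cvg A.
Proof.
apply: (@weighted_complete R _ R S (@linfty_fun R S) (cst 1)) => //.
- by move=> u s; rewrite mul1r; exact: supnorm_ub.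
- by move=> u M M0 uM; apply: supnorm_le => // s; rewrite -[M]mul1r.
move=> g g_lim; suff /asboolP gb : exists k, forall s, `|g s| <= k.
  by exists (Linfty gb).
have [u gu] := g_lim _ ltr01; exists (1 + supnorm u) => s.
rewrite -[g s](subrK (u s)) (le_trans (ler_normD _ _))//.
by rewrite lerD ?supnorm_ub// (le_trans (gu s))// mulr1.
Qed.

HB.instance Definition _ :=
  Uniform_isComplete.Build (linfty R S) linfty_complete.

End Linfty.

Definition unit_ball (R : realType) (E : normedModType R) : set E :=
  [set x | `|x| < 1].
Arguments unit_ball {R} E.

Definition linfty_dual_ball (R : realType) (E : normedModType R) :
  completeNormedModType R := linfty R (unit_ball (dual E)).

Record closed_subspace (R : realType) (E : normedModType R) := ClosedSubspace {
  subspace_set :> set E;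
  subspace0 : subspace_set 0;
  subspaceP : forall a x y, subspace_set x -> subspace_set y ->
    subspace_set (a *: x + y);
  subspace_closed : closed subspace_set }.

Definition subspace_pred (R : realType) (E : normedModType R)
  (M : closed_subspace E) : E -> bool := fun x => x \in (M : set E).

Section SubspacePred.
Context {R : realType} {E : normedModType R} (M : closed_subspace E).

Lemma subspace_submod : submod_closed (subspace_pred M).
Proof.
split=> [|a x y]; first by apply/mem_set/subspace0.
by move=> /set_mem Mx /set_mem My; exact/mem_set/subspaceP.
Qed.

HB.instance Definition _ := GRing.isSubmodClosed.Build R E (subspace_pred M)
  subspace_submod.

End SubspacePred.

Definition quot_group (R : realType) (E : normedModType R)
  (M : closed_subspace E) :=
  Quotient.quot (GRing.ZmodClosed.clone E (subspace_pred M) _).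

Definition bquot (R : realType) (E : normedModType R)
  (M : closed_subspace E) : Type := quot_group M.

Section BQuot.
Context {R : realType} {E : normedModType R} {M : closed_subspace E}.

HB.instance Definition _ := GRing.Zmodule.on (bquot M).

Definition bquot_pi (x : E) : bquot M :=
  \pi_(quot_group M)%qT x.

Local Notation pi := bquot_pi.

Lemma bquot_piP x y : pi x = pi y <-> subspace_set M (x - y).
Proof.
rewrite /bquot_pi; split=> [/eqP|Mxy].
  by rewrite -Quotient.idealrBE => /set_mem.
by apply/eqP; rewrite -Quotient.idealrBE; exact/mem_set.
Qed.

Lemma bquot_piD x y : pi (x + y) = pi x + pi y.
Proof. by rewrite /bquot_pi raddfD. Qed.

Lemma bquot_pi_surj (q : bquot M) : exists x, pi x = q.
Proof. by exists (repr (q : quot_group M)); exact: reprK. Qed.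

Lemma bquot_piB x y : pi (x - y) = pi x - pi y.
Proof. by rewrite /bquot_pi raddfB. Qed.

Lemma bquot_pi0 : pi 0 = 0.
Proof. by rewrite /bquot_pi raddf0. Qed.

Definition bquot_repr (q : bquot M) : E := projT1 (cid (bquot_pi_surj q)).

Lemma bquot_reprK : cancel bquot_repr pi.
Proof. by move=> q; rewrite /bquot_repr; case: cid. Qed.

Definition bquot_scale (a : R) (q : bquot M) : bquot M :=
  pi (a *: bquot_repr q).

Lemma subspaceZ a x : subspace_set M x -> subspace_set M (a *: x).
Proof. by move=> Mx; rewrite -[_ *: _]addr0; apply/subspaceP/subspace0. Qed.

Lemma bquot_scale_pi a x : bquot_scale a (pi x) = pi (a *: x).
Proof.
by apply/bquot_piP; rewrite -scalerBr; apply/subspaceZ/bquot_piP/bquot_reprK.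
Qed.

Let scaleA a b q : bquot_scale a (bquot_scale b q) = bquot_scale (a * b) q.
Proof. by rewrite -(bquot_reprK q) !bquot_scale_pi scalerA. Qed.

Let scale1 : left_id 1 bquot_scale.
Proof. by move=> q; rewrite -(bquot_reprK q) bquot_scale_pi scale1r. Qed.

Let scaleDr : right_distributive bquot_scale +%R.
Proof.
move=> a p q; rewrite -(bquot_reprK p) -(bquot_reprK q) -bquot_piD.
by rewrite !bquot_scale_pi scalerDr bquot_piD.
Qed.

Let scaleDl q : {morph bquot_scale^~ q : a b / a + b}.
Proof.
by move=> a b; rewrite -(bquot_reprK q) !bquot_scale_pi scalerDl bquot_piD.
Qed.

HB.instance Definition _ := GRing.Zmodule_isLmodule.Build R (bquot M)
  scaleA scale1 scaleDr scaleDl.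

Lemma bquot_pi_linear : linear pi.
Proof. by move=> a x y; rewrite bquot_piD -bquot_scale_pi. Qed.

Definition bquot_norm (q : bquot M) : R :=
  inf [set `|x| | x in pi @^-1` [set q]].

Lemma bquot_norm_has_inf (q : bquot M) :
  has_inf [set `|x| | x in pi @^-1` [set q]].
Proof.
split; first by have [x xq] := bquot_pi_surj q; exists `|x|, x.
by exists 0 => _ [x _ <-].
Qed.

Lemma bquot_norm_le x : bquot_norm (pi x) <= `|x|.
Proof. by apply: (ge_inf (bquot_norm_has_inf _).2); exists x. Qed.

Lemma bquot_norm_ge0 q : 0 <= bquot_norm q.
Proof.
by apply: lb_le_inf => [|_ [x _ <-]//]; exact: (bquot_norm_has_inf q).1.
Qed.

Lemma bquot_norm_lift (q : bquot M) (e : R) : 0 < e ->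
  exists2 x, pi x = q & `|x| < bquot_norm q + e.
Proof.
move=> e0; have [_ [x xq <-] xe] := inf_adherent e0 (bquot_norm_has_inf q).
by exists x.
Qed.

Let normD p q : bquot_norm (p + q) <= bquot_norm p + bquot_norm q.
Proof.
apply/ler_addgt0Pl => e e0; have e20 : 0 < e / 2 by rewrite divr_gt0.
have [x <- xe] := bquot_norm_lift p e20.
have [y <- ye] := bquot_norm_lift q e20.
rewrite -bquot_piD (le_trans (bquot_norm_le _))// (le_trans (ler_normD _ _))//.
by rewrite (le_trans (lerD (ltW xe) (ltW ye)))// addrACA -splitr addrC.
Qed.

Let normZ_le a q : bquot_norm (a *: q) <= `|a| * bquot_norm q.
Proof.
apply/ler_addgt0Pl => e e0; have e10 : 0 < e / (`|a| + 1).
  by rewrite divr_gt0// ltr_wpDl.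
have [x xq xe] := bquot_norm_lift q e10.
have -> : a *: q = pi (a *: x) by rewrite -xq -bquot_scale_pi.
rewrite (le_trans (bquot_norm_le _))// normrZ.
rewrite (le_trans (ler_wpM2l (normr_ge0 a) (ltW xe)))// mulrDr addrC lerD2r.
by rewrite mulrCA ger_pMr// ler_pdivrMr ?mul1r ?lerDl// ltr_wpDl.
Qed.

Let normZ a q : bquot_norm (a *: q) = `|a| * bquot_norm q.
Proof.
apply/eqP; rewrite eq_le normZ_le/=.
have [->|a0] := eqVneq a 0; first by rewrite normr0 mul0r bquot_norm_ge0.
rewrite -ler_pdivlMl ?normr_gt0// -normfV (le_trans _ (normZ_le _ _))//.
by rewrite scalerA mulVf// scale1r.
Qed.

Let norm_eq0 q : bquot_norm q = 0 -> q = 0.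
Proof.
have [x <-] := bquot_pi_surj q => x0; rewrite -bquot_pi0.
apply/bquot_piP; rewrite subr0; apply: subspace_closed => B.
move=> /nbhs_ballP[e /= e0 eB].
have [y yx] := bquot_norm_lift (pi x) e0.
rewrite x0 add0r => ye; exists (x - y); split.
  by apply/bquot_piP.
by apply: eB; rewrite -ball_normE/= opprB addrC subrK.
Qed.

HB.instance Definition _ := @Lmodule_isNormed.Build R (bquot M) bquot_norm
  normD normZ norm_eq0.

End BQuot.

Section BQuotComplete.
Context {R : realType} {E : completeNormedModType R} {M : closed_subspace E}.

Local Notation pi := (@bquot_pi R E M).

(* Lifts the increments of a fast Cauchy sequence of ball centers. *)
Let bquot_complete (F : set_system (bquot M)) :
  ProperFilter F -> cauchy F -> cvg F.
Proof.
move=> FF /cauchyP Fc; pose r n : R := 2^-1 ^+ n.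
have r0 n : 0 < r n by rewrite exprn_gt0// invr_gt0.
have hlt1 : `|2^-1 : R| < 1 by rewrite gtr0_norm ?invr_gt0// invf_lt1// ltr1n.
have /choice[c Fcr] n : exists q, F (ball q (r n)) by exact: Fc.
have cS n : `|c n.+1 - c n| < 2 * r n.
  have [q [/= ]] : (ball (c n) (r n) `&` ball (c n.+1) (r n.+1)) !=set0.
    by apply: (@filter_ex _ F); apply: filterI.
  rewrite -!ball_normE/= => cnq cSq.
  rewrite -(subrKA q) (le_lt_trans (ler_normD _ _))// mulr_natl mulr2n.
  rewrite distrC in cnq; rewrite ltrD// (lt_le_trans cSq)// /r exprS.
  by rewrite ler_piMl ?(ltW (r0 n))// invf_le1// ler1n.
have /choice[y yP] n : exists y, pi y = c n.+1 - c n /\ `|y| <= 3 * r n.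
  have [y yc yr] := bquot_norm_lift (c n.+1 - c n) (r0 n).
  exists y; split => //; rewrite (le_trans (ltW yr))//.
  by rewrite -[3]/(2 + 1)%:R natrD mulrDl mul1r lerD2r ltW// cS.
have /cvg_ex[l /= yl] : cvgn (series y).
  apply: normed_cvg; apply: (@series_le_cvg _ _ (geometric 3 2^-1)) => //=.
  - by move=> n; have [_] := yP n.
  - exact: is_cvg_geometric_series.
have [x0 x0c] := bquot_pi_surj (c 0%N).
have xc n : pi (x0 + series y n) = c n.
  elim: n => [|n IHn]; first by rewrite /series/= big_geq// addr0.
  rewrite /series/= big_nat_recr//= addrA bquot_piD IHn.
  by have [-> _] := yP n; rewrite addrC subrK.
apply: (cvgP (pi (x0 + l))); apply/(@cvgrPdist_le _ _ _ F _ id) => e e0.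
have e20 : 0 < e / 2 by rewrite divr_gt0.
have [n [/= ln rn]] : ([set n | `|l - series y n| <= e / 2] `&`
    [set n | r n <= e / 2]) !=set0.
  apply: (@filter_ex _ \oo); apply: filterI.
    by move/cvgrPdist_le : yl; exact.
  have /cvgrPdist_le/(_ _ e20) := cvg_expr hlt1.
  apply: filterS => n /=; rewrite sub0r normrN; apply: le_trans.
  exact: ler_norm.
apply: filterS (Fcr n) => q; rewrite -ball_normE/= => cq.
rewrite -(subrKA (c n)) (le_trans (ler_normD _ _))// [e]splitr lerD//.
  rewrite -xc -bquot_piB (le_trans (bquot_norm_le _))//.
  by rewrite opprD addrACA subrr add0r.
by rewrite (le_trans (ltW cq)).
Qed.

HB.instance Definition _ :=
  Uniform_isComplete.Build (bquot M) bquot_complete.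

End BQuotComplete.

Definition finite_codim (R : realType) (E : normedModType R)
    (M : closed_subspace E) : Prop :=
  exists n (e : 'I_n -> bquot M), forall q, exists c : 'I_n -> R,
    q = \sum_(i < n) c i *: e i.

(* The class is given by its components.  The norm is a total function, but
   its values are constrained, and used, on the members of the class only. *)
Record banach_lip_ideal (R : realType) := BanachLipIdeal {
  ideal_mem : forall (X : pmetricType R) (E : completeNormedModType R),
    set (X -> E);
  ideal_norm : forall (X : pmetricType R) (E : completeNormedModType R),
    (X -> E) -> R;
  ideal_Lip0 : forall (X : pmetricType R) (E : completeNormedModType R)
      (f : X -> E),
    ideal_mem f -> Lip0 (Y := normed_metric E) f;
  ideal0 : forall (X : pmetricType R) (E : completeNormedModType R),
    ideal_mem (0 : X -> E);
  idealP : forall (X : pmetricType R) (E : completeNormedModType R)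
      (a : R) (f g : X -> E),
    ideal_mem f -> ideal_mem g -> ideal_mem (a *: f + g);
  ideal_norm_ge0 : forall (X : pmetricType R) (E : completeNormedModType R)
      (f : X -> E),
    ideal_mem f -> 0 <= ideal_norm f;
  ideal_norm_eq0 : forall (X : pmetricType R) (E : completeNormedModType R)
      (f : X -> E),
    ideal_mem f -> ideal_norm f = 0 -> f = 0;
  ideal_normZ : forall (X : pmetricType R) (E : completeNormedModType R)
      (a : R) (f : X -> E),
    ideal_mem f -> ideal_norm (a *: f) = `|a| * ideal_norm f;
  ideal_normD : forall (X : pmetricType R) (E : completeNormedModType R)
      (f g : X -> E),
    ideal_mem f -> ideal_mem g ->
    ideal_norm (f + g) <= ideal_norm f + ideal_norm g;
  ideal_complete : forall (X : pmetricType R) (E : completeNormedModType R)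
      (u : nat -> X -> E),
    (forall n, ideal_mem (u n)) ->
    (forall e : R, 0 < e -> exists N, forall m n, (N <= m)%N -> (N <= n)%N ->
      ideal_norm (u m - u n) <= e) ->
    exists2 f, ideal_mem f & ideal_norm (u n - f) @[n --> \oo] --> (0 : R);
  ideal_Lip_le : forall (X : pmetricType R) (E : completeNormedModType R)
      (f : X -> E),
    ideal_mem f -> Lip (Y := normed_metric E) f <= ideal_norm f;
  ideal_id : ideal_mem (id : normed_metric R -> R);
  ideal_norm_id : ideal_norm (id : normed_metric R -> R) = 1;
  ideal_comp : forall (X Y : pmetricType R) (E F : completeNormedModType R)
      (g : Y -> X) (f : X -> E) (S : blin E F),
    Lip0 g -> ideal_mem f -> ideal_mem (S \o f \o g);
  ideal_norm_comp : forall (X Y : pmetricType R)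
      (E F : completeNormedModType R) (g : Y -> X) (f : X -> E) (S : blin E F),
    Lip0 g -> ideal_mem f ->
    ideal_norm (S \o f \o g) <= Lip g * ideal_norm f * `|S| }.

Section Ideal.
Context {R : realType} (I : banach_lip_ideal R).

Definition ideal_lin (E F : completeNormedModType R) : set (blin E F) :=
  [set U | ideal_mem I (U : normed_metric E -> F)].

Definition ideal_lin_norm (E F : completeNormedModType R) (U : blin E F) : R :=
  ideal_norm I (U : normed_metric E -> F).

(* The maps Q \o f \o iota below always belong to [I], their domain being
   finite and their codomain finite-dimensional. *)
Definition max_norm (X : pmetricType R) (E : completeNormedModType R)
    (f : X -> E) : \bar R :=
  ereal_sup [set y | exists (X0 : set X) (X0pt : X0 point)
      (M : closed_subspace E),
    [/\ finite_set X0, finite_codim M &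
      y = (ideal_norm I (@bquot_pi R E M \o f \o @incl R X X0 X0pt))%:E]].

Definition max_mem (X : pmetricType R) (E : completeNormedModType R) :
    set (X -> E) :=
  [set f | Lip0 (Y := normed_metric E) f /\ (max_norm f < +oo)%E].

Definition maximal_ideal : Prop :=
  forall (X : pmetricType R) (E : completeNormedModType R) (f : X -> E),
    (ideal_mem I f <-> max_mem f) /\
    (ideal_mem I f -> (ideal_norm I f)%:E = max_norm f).

End Ideal.

Section Translation.
Context {R : realType} {E : completeNormedModType R}.

(* A subset of a Banach space containing 0, as a pointed metric space. *)
Definition banach_sub (X : set E) (X0 : X 0) : pmetricType R :=
  @metric_sub R (normed_metric E) X X0.

Definition translate_set (X : set E) (x0 : E) : set E :=
  [set x - x0 | x in X].

Lemma translate_set0 (X : set E) (x0 : E) : X x0 -> translate_set X x0 0.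
Proof. by move=> Xx0; exists x0; rewrite ?subrr. Qed.

Lemma translate_setK (X : set E) (x0 z : E) :
  z \in translate_set X x0 -> z + x0 \in X.
Proof. by move=> /set_mem[x Xx <-]; rewrite subrK; exact/mem_set. Qed.

(* [f^{x0} z = f (z + x0) - f x0]. *)
Definition translate_map (F : completeNormedModType R) (X : set E) (x0 : E)
    (Xx0 : X x0) (f : X -> F) (z : translate_set X x0) : F :=
  f (exist _ (val z + x0) (translate_setK (valP z))) -
  f (exist _ x0 (mem_set Xx0)).

End Translation.

Definition translation_invariant (R : realType) (I : banach_lip_ideal R) :
    Prop :=
  forall (E F : completeNormedModType R) (X : set E) (X0 : X 0) (x0 : E)
      (Xx0 : X x0) (f : banach_sub X0 -> F),
    Lip0 (Y := normed_metric F) f ->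
    let fx0 : banach_sub (translate_set0 Xx0) -> F := translate_map Xx0 f in
    (ideal_mem I f <-> ideal_mem I fx0) /\
    (ideal_mem I f -> ideal_norm I f = ideal_norm I fx0).

(* Main.v *)
Require Import Defs.
From HB Require Import structures.
From mathcomp Require Import all_boot all_order all_algebra.
From mathcomp Require Import all_classical all_reals all_analysis.

(* Let Z = l_infty(B_E') and let j : E -> Z be the canonical isometric
   embedding.  After a translation f(0) = 0, and as Z is injective for
   Lipschitz maps, f = f~ o j with Lip(f~) <= Lip(f); so h = g o f~ belongs to
   I, has norm at most Lip(f) |g|, and extends the linear map T o j^-1.  Then h
   is made linear by taking an invariant mean of its translates
   z |-> h(z + w) - h(w), first over w in j(E), which makes h additive along
   j(E) without changing it there, then over w in Z.

   The mean is a weak* limit of convex combinations of translates, so one needs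
   the balls of I(X, F') to be weak*-closed.  Maximality reduces this to finite
   X and to quotients Q : F' -> G of finite dimension.  Q need not be
   weak*-continuous, but by a local reflexivity argument (two applications of
   Hahn-Banach and the duality l_infty^N(F)' = l_1^N(F')) the bounds obtained
   for weak*-continuous operators F' -> G pass to Q. *)

Set Implicit Arguments.
Unset Strict Implicit.
Unset Printing Implicit Defensive.

Import Order.TTheory GRing.Theory Num.Theory.
Import numFieldNormedType.Exports.

Local Open Scope classical_set_scope.
Local Open Scope ring_scope.

(** * The Hahn-Banach theorem *)

Lemma scalar_map0 (R : pzRingType) (V : lmodType R) (f : V -> R) :
  scalar f -> f 0 = 0.
Proof.
by move=> fl; have := fl (-1) 0 0; rewrite scaler0 addr0 mulN1r addNr.
Qed.

Lemma scalar_mapD (R : pzRingType) (V : lmodType R) (f : V -> R) v w :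
  scalar f -> f (v + w) = f v + f w.
Proof. by move=> fl; rewrite -[v]scale1r fl mul1r scale1r. Qed.

Lemma scalar_mapZ (R : pzRingType) (V : lmodType R) (f : V -> R) a v :
  scalar f -> f (a *: v) = a * f v.
Proof. by move=> fl; rewrite -[_ *: _]addr0 fl scalar_map0// addr0. Qed.

Lemma scalar_map_sum (R : pzRingType) (V : lmodType R) (f : V -> R) (T : Type)
    (r : seq T) (a : T -> R) (v : T -> V) : scalar f ->
  f (\sum_(i <- r) a i *: v i) = \sum_(i <- r) a i * f (v i).
Proof.
move=> fl; elim/big_rec2 : _ => [|i y w _ <-]; [exact: scalar_map0|exact: fl].
Qed.

Section HahnBanach.
Context {R : realType} {V : lmodType R}.
Variable p : V -> R.
Hypothesis pZ : forall a v, 0 < a -> p (a *: v) = a * p v.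
Hypothesis pD : forall v w, p (v + w) <= p v + p w.

Let p0 : p 0 = 0.
Proof.
have := @pZ 2 0 (ltr0Sn _ 1); rewrite scaler0 mulr_natl mulr2n => /eqP.
by rewrite -subr_eq0 opprD addNKr oppr_eq0 => /eqP.
Qed.

(* Domination by [p] forces the linear subspace [G] to be the graph of a
   function. *)
Let lin_graph (G : set (V * R)) :=
  (forall a x r y s, G (x, r) -> G (y, s) -> G (a *: x + y, a * r + s)) /\
  (forall x r, G (x, r) -> r <= p x).

Let lin_graph0 G x r : lin_graph G -> G (x, r) -> G (0, 0).
Proof.
move=> [Glin _] Gxr; have := Glin (-1) _ _ _ _ Gxr Gxr.
by rewrite scaleN1r mulN1r !addNr.
Qed.

Let lin_graph_fun G x r s : lin_graph G -> G (x, r) -> G (x, s) -> r = s.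
Proof.
move=> GL Gxr Gxs; have [Glin Gp] := GL; have G00 := lin_graph0 GL Gxr.
have G0 a : a * (s - r) <= 0.
  have := Glin (-1) _ _ _ _ Gxr Gxs; rewrite scaleN1r mulN1r addNr addrC => Grs.
  by have := Gp _ _ (Glin a _ _ _ _ Grs G00); rewrite scaler0 !addr0 p0.
apply/eqP; rewrite eq_le -(subr_le0 r) -(subr_le0 s).
by have := G0 1; have := G0 (-1); rewrite mul1r mulN1r opprB => -> ->.
Qed.

(** The one-dimensional step. By subadditivity every [s - p (y - v)] lies below every
    [p (x + v) - r], so the supremum of the former can serve as [c]; rescaling gives domination for
    both signs of [t]. *)
Let lin_graph_extend G v : lin_graph G -> G (0, 0) ->
  exists c, lin_graph [set z | exists x r t, G (x, r) /\
    z = (x + t *: v, r + t * c)].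
Proof.
move=> [Glin Gp] G00.
pose C := [set z | exists x r, G (x, r) /\ z = r - p (x - v)].
have Cub x r y s : G (x, r) -> G (y, s) -> s - p (y - v) <= p (x + v) - r.
  move=> Gxr Gys; rewrite lerBrDr addrAC lerBlDr.
  have := Gp _ _ (Glin 1 _ _ _ _ Gys Gxr); rewrite scale1r mul1r.
  move=> /le_trans; apply.
  have -> : y + x = (x + v) + (y - v) by rewrite [RHS]addrC [x + v]addrC subrKA.
  exact: pD.
have hC : has_sup C.
  split; first by exists (0 - p (0 - v)), 0, 0.
  by exists (p (0 + v) - 0) => _ [y [s [Gys ->]]]; exact: Cub.
exists (sup C); split.
  move=> a _ _ _ _ [x [r [t [Gxr [-> ->]]]]] [y [s [t' [Gys [-> ->]]]]].
  exists (a *: x + y), (a * r + s), (a * t + t'); split; first exact: Glin.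
  rewrite scalerDr scalerDl scalerA mulrDr mulrDl mulrA.
  by congr (_, _); exact: addrACA.
move=> _ _ [x [r [t [Gxr [-> ->]]]]].
have GZ a : G (a *: x, a * r).
  by have := Glin a _ _ _ _ Gxr G00; rewrite !addr0.
have [t0|t0|->] := ltgtP t 0; last by rewrite scale0r mul0r !addr0; exact: Gp.
  have := sup_ubound hC.2; have nt0 : 0 < - t by rewrite oppr_gt0.
  move=> /(_ ((- t)^-1 * r - p ((- t)^-1 *: x - v))) => /(_ _)/wrap[].
    by exists ((- t)^-1 *: x), ((- t)^-1 * r).
  rewrite -(ler_pM2l nt0) mulrBr mulVKf ?gt_eqF// -pZ// scalerBr scalerA.
  rewrite divff ?gt_eqF// scale1r scaleNr opprK => h.
  by move: h; rewrite mulNr lerBlDr addrC -lerBlDr opprK.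
have : sup C <= p (t^-1 *: x + v) - t^-1 * r.
  by apply: ge_sup hC.1 _ => _ [y [s [Gys ->]]]; exact: Cub.
rewrite -(ler_pM2l t0) mulrBr mulVKf ?gt_eqF// -pZ// scalerDr scalerA.
by rewrite divff ?gt_eqF// scale1r lerBrDr addrC.
Qed.

(** The functional to extend lives on the image of [b], which need not be injective: domination by
    [p] makes [u] factor through [b]. A maximal dominated graph is defined everywhere by
    [lin_graph_extend]. *)
Theorem hahn_banach (W : lmodType R) (b : W -> V) (u : W -> R) :
  linear b -> scalar u -> (forall w, u w <= p (b w)) ->
  exists th : V -> R,
    [/\ scalar th, forall v, th v <= p v & forall w, th (b w) = u w].
Proof.
move=> blin ulin up; pose G0 := [set z | exists w, z = (b w, u w)].
have G0L : lin_graph G0.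
  split; last by move=> _ _ [w [-> ->]].
  move=> a _ _ _ _ [w [-> ->]] [w' [-> ->]].
  by exists (a *: w + w'); rewrite blin ulin.
(* Only a nonempty graph is asked to contain [G0], so that the union of the empty chain satisfies
   [P]. *)
pose P (G : set (V * R)) := lin_graph G /\ (forall z, G z -> G0 `<=` G).
have [|A [[AL AG0] Amax]] := @Zorn_bigcup _ P.
  move=> F FP Ftot; split.
    split; last by move=> x r [X FX]; exact: (FP _ FX).1.2.
    move=> a x r y s [X FX Xx] [Y FY Yy].
    have [XY|YX] := Ftot _ _ FX FY.
      by exists Y => //; apply: (FP _ FY).1.1 => //; exact: XY.
    by exists X => //; apply: (FP _ FX).1.1 => //; exact: YX.
  by move=> z [X FX Xz] y G0y; exists X => //; exact: (FP _ FX).2 Xz _ G0y.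
(* Otherwise [A] would be empty and [G0] would properly extend it. *)
have AG : G0 `<=` A.
  apply: contrapT => nA; apply: (Amax G0); last by split => // z _.
  split=> // z Az; apply: contrapT => _; apply: nA; exact: AG0 Az.
have A00 : A (0, 0).
  by apply: (@lin_graph0 _ (b 0) (u 0)) => //; apply: AG; exists 0.
have /choice[th thA] v : exists r, A (v, r).
  apply: contrapT => nA.
  have [c BL] := lin_graph_extend v AL A00.
  set B := [set _ | _] in BL; apply: (Amax B); last first.
    split=> // _ _; apply: subset_trans AG _ => -[x r] Axr.
    by exists x, r, 0; rewrite scale0r mul0r !addr0.
  split; last first.
    move=> BA; apply: nA; exists c; apply: BA; exists 0, 0, 1.
    by rewrite scale1r mul1r !add0r.
  by move=> -[x r] Axr; exists x, r, 0; rewrite scale0r mul0r !addr0.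
exists th; split.
- by move=> a x y; apply: (lin_graph_fun AL (thA _)); exact: AL.1.
- by move=> v; exact: AL.2.
by move=> w; apply: (lin_graph_fun AL (thA _)); apply: AG; exists w.
Qed.

End HahnBanach.

(** * Bounded operators and finite-dimensional spaces *)

Lemma cvg_sum (K : numFieldType) (V : normedModType K) (T J : Type)
    (F : set_system T) {FF : Filter F} (r : seq J) (f : J -> T -> V)
    (l : J -> V) :
  (forall j, f j x @[x --> F] --> l j) ->
  \sum_(j <- r) f j x @[x --> F] --> \sum_(j <- r) l j.
Proof. by move=> fl; apply: cvg_big => //; exact: add_continuous. Qed.

Section Operators.
Context {R : realType}.
Implicit Types E F G : normedModType R.

Lemma bounded_linearP E F (f : E -> F) (k : R) :
  linear f -> (forall x, `|f x| <= k * `|x|) -> bounded_linear f.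
Proof. by move=> fl fk; apply/asboolP; split=> //; exists k. Qed.

Lemma blin_ub E F (f : blin E F) x : `|f x| <= `|f| * `|x|.
Proof. exact: opnorm_ub. Qed.

Lemma blin_le E F (f : blin E F) (M : R) :
  0 <= M -> (forall x, `|f x| <= M * `|x|) -> `|f| <= M.
Proof. by move=> M0 fM; apply: opnorm_le => // x; rewrite mulrC. Qed.

Lemma blin_continuous E F (f : blin E F) : continuous f.
Proof.
move=> x; apply/cvgrPdist_le => e e0.
have f1 : 0 < `|f| + 1 by rewrite ltr_wpDl.
near=> z; rewrite -linearB (le_trans (blin_ub f _))//.
have -> : e = (`|f| + 1) * (e / (`|f| + 1)) by rewrite mulrC divfK// gt_eqF.
apply: ler_pM => //; first by rewrite lerDl.
by near: z; apply: cvgr_dist_le; rewrite ?divr_gt0.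
Unshelve. all: by end_near. Qed.

Lemma blin_sumE E F (J : Type) (r : seq J) (f : J -> blin E F) x :
  (\sum_(j <- r) f j) x = \sum_(j <- r) f j x.
Proof. by elim/big_ind2 : _ => // g1 y1 g2 y2 <- <-. Qed.

Lemma blin_almost_norming E (y : blin E R) (e : R) : 0 < e ->
  exists2 x, `|x| <= 1 & `|y| - e <= y x.
Proof.
move=> e0; have [_ [x /= x1 <-] xe] := sup_adherent e0 (opnorm_has_sup y).
have [yx0|yx0] := leP 0 (y x).
  by exists x => //; rewrite ger0_norm// in xe; exact: ltW.
by exists (- x); rewrite ?normrN// linearN/= -(ltr0_norm yx0) ltW.
Qed.

Lemma norming_functional E (x : E) :
  exists2 y : blin E R, `|y| <= 1 & y x = `|x|.
Proof.
have [|||||th [thl thn thx]] := @hahn_banach R E Num.norm _ _ R^o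
    ( *:%R^~ x) (fun t => t * `|x|).
- by move=> a v a0; rewrite normrZ gtr0_norm.
- exact: ler_normD.
- by move=> a t t'; rewrite scalerDl scalerA.
- by move=> a t t'; rewrite mulrDl mulrA.
- by move=> t /=; rewrite normrZ ler_wpM2r// ler_norm.
have thb v : `|th v| <= 1 * `|v|.
  rewrite mul1r ler_norml thn andbT lerNl.
  by rewrite -mulN1r -scalar_mapZ// scaleN1r -normrN thn.
exists (BLin (bounded_linearP thl thb)); first by apply: (@blin_le E R^o).
by rewrite /= -[x in th x]scale1r thx mul1r.
Qed.

End Operators.

(** A spanning family of least size is free, since a nontrivial relation would make one member
    redundant; uniqueness of coordinates then makes them linear. *)
Lemma finite_basis (R : fieldType) (G : lmodType R) n (e : 'I_n -> G) :
  (forall v, exists c : 'I_n -> R, v = \sum_(i < n) c i *: e i) ->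
  exists m (b : 'I_m -> G) (c : G -> 'I_m -> R),
    [/\ forall i, scalar (c ^~ i), forall v, v = \sum_(i < m) c v i *: b i &
        forall a : 'I_m -> R, \sum_(i < m) a i *: b i = 0 -> forall i, a i = 0].
Proof.
move=> en; pose span m := exists b : 'I_m -> G,
  forall v, exists c : 'I_m -> R, v = \sum_(i < m) c i *: b i.
have sn : exists m, `[< span m >] by exists n; apply/asboolP; exists e.
case: (ex_minnP sn) => m /asboolP[b bs] mmin.
have bfree (a : 'I_m -> R) : \sum_(i < m) a i *: b i = 0 -> forall i, a i = 0.
  move=> ab0 k; apply/eqP/negP => /negP ak0.
  case: m => [|m] in b bs mmin a ab0 k ak0 *; first by case: k {ak0}.
  suff : (m.+1 <= m)%N by rewrite ltnn.
  apply: mmin; apply/asboolP; exists (b \o lift k) => v.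
  have [c vc] := bs v.
  (* Subtracting [c k / a k] times the relation kills the coefficient of [b k]. *)
  exists (fun i => c (lift k i) - c k / a k * a (lift k i)).
  have -> : v = v - (c k / a k) *: \sum_(i < m.+1) a i *: b i.
    by rewrite ab0 scaler0 subr0.
  rewrite [in LHS]vc scaler_sumr -sumrB.
  under eq_bigr do rewrite scalerA -scalerBl.
  by rewrite (bigD1_ord k)//= divfK// subrr scale0r add0r.
have [c cP] := choice bs.
exists m, b, c; split => // i a v w.
apply/eqP; rewrite -subr_eq0; apply/eqP.
apply: (bfree (fun i => c (a *: v + w) i - (a * c v i + c w i))).
under eq_bigr do rewrite scalerBl scalerDl -scalerA.
by rewrite sumrB big_split/= -scaler_sumr -!cP subrr.
Qed.

(** Compactness of the unit sphere of coordinates: a functional norming one point still norms up to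
    [1 + eps] on a neighbourhood, and finitely many neighbourhoods cover the sphere. *)
Lemma finite_norming (R : realType) (G : normedModType R) n (b : 'I_n -> G)
    (c : G -> 'I_n -> R) (eps : R) :
  (forall v, v = \sum_(i < n) c v i *: b i) ->
  (forall a : 'I_n -> R, \sum_(i < n) a i *: b i = 0 -> forall i, a i = 0) ->
  0 < eps ->
  exists s : seq (blin G R), (forall y, y \in s -> `|y| <= 1) /\
    forall v, v != 0 -> exists2 y, y \in s & `|v| < (1 + eps) * y v.
Proof.
move=> cb bfree eps0.
pose m (a : 'rV[R]_n) := \sum_(i < n) a ord0 i *: b i.
have mcont : continuous m.
  move=> a; apply: (@cvg_sum _ _ _ _ (nbhs a)) => i; apply: cvgZr_tmp.
  exact: coord_continuous.
have mlin : linear m.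
  move=> k u v; rewrite /m scaler_sumr -big_split/=; apply: eq_bigr => i _.
  by rewrite !mxE scalerDl scalerA.
pose S := [set a : 'rV[R]_n | `|a| = 1].
have Scpt : compact S.
  apply: bounded_closed_compact.
    by exists 1; split=> // x x1 a /= ->; exact: ltW.
  apply: (@preimage_closed _ R^o (Num.norm : 'rV[R]_n -> R^o) [set x | x = 1]).
    by move=> a _; exact: norm_continuous.
  exact: closed_eq.
have /choice[y yP] a : exists y : blin G R, `|y| <= 1 /\ y (m a) = `|m a|.
  by have [y] := norming_functional (m a); exists y.
pose f a := [set a' | `|m a'| < (1 + eps) * y a (m a')].
have fop a : S a -> open (f a).
  move=> _; have -> : f a = (fun a' => `|m a'| - (1 + eps) * y a (m a')) @^-1`
      [set x | x < 0].
    by apply/seteqP; split => a' /=; rewrite subr_lt0.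
  have sub_cvg (F : set_system 'rV[R]_n) (FF : Filter F) (l : G) :
      m @ F --> l ->
      `|m z| - (1 + eps) * y a (m z) @[z --> F] --> `|l| - (1 + eps) * y a l.
    move=> ml; apply: cvgB; first exact: cvg_norm.
    apply: cvgMl_tmp; apply: cvg_comp ml _.
    exact: (@blin_continuous R G R^o (y a)).
  apply: open_comp (@open_lt _ 0) => a' _.
  exact: (sub_cvg _ (nbhs_filter a') _ (mcont a')).
have Sf : S `<=` \bigcup_(a in S) f a.
  move=> a Sa; exists a => //; rewrite /f/= (yP a).2 ltr_pMl ?ltrDl//.
  rewrite normr_gt0; apply/eqP => /bfree a0.
  have : a = 0 by apply/rowP => i; rewrite a0 mxE.
  by move/eqP; rewrite -normr_eq0 Sa oner_eq0.
move: Scpt; rewrite compact_cover => /(_ _ _ _ fop Sf)[D' D'S D'f].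
exists [seq y a | a <- finmap.enum_fset D']; split.
  by move=> _ /mapP[a _ ->]; exact: (yP a).1.
move=> v v0; pose a := \row_i c v i.
have mav : m a = v by rewrite [RHS]cb; apply: eq_bigr => i _; rewrite mxE.
have a0 : 0 < `|a|.
  rewrite normr_gt0; apply: contra_neq v0 => a0; rewrite -mav a0.
  by rewrite /m big1// => i _; rewrite mxE scale0r.
have Sa : S (`|a|^-1 *: a).
  by rewrite /S/= normrZ ger0_norm ?invr_ge0// mulVf// gt_eqF.
have [a' a'D] := D'f _ Sa.
have -> : f a' (`|a|^-1 *: a) = (`|v| < (1 + eps) * y a' v) :> Prop.
  rewrite /f/= -[_ *: _]addr0 mlin [m 0]big1 ?addr0; last first.
    by move=> i _; rewrite mxE scale0r.
  rewrite mav linearZ normrZ ger0_norm ?invr_ge0// [in X in _ < X]mulrCA.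
  by rewrite ltr_pM2l ?invr_gt0.
by move=> h; exists (y a') => //; apply: map_f.
Qed.

(** * Lipschitz operator ideals *)

Section Lip.
Context {R : realType}.
Implicit Types X Y : pmetricType R.

Lemma Lip_ge0 X Y (f : X -> Y) : is_lipschitz f -> 0 <= Lip f.
Proof. by move=> fL; apply: lb_le_inf => // k []. Qed.

Lemma Lip_le X Y (f : X -> Y) k : lip_bound f k -> Lip f <= k.
Proof. by move=> fk; apply: ge_inf => //; exists 0 => l []. Qed.

(** The infimum defining [Lip] is attained: divide by the distance of two distinct points. *)
Lemma Lip_bound X Y (f : X -> Y) : is_lipschitz f -> lip_bound f (Lip f).
Proof.
move=> fL; split=> [|x y]; first exact: Lip_ge0.
have [->|xy] := eqVneq x y; first by rewrite !mdistxx mulr0.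
rewrite -ler_pdivrMr ?mdist_gt0//; apply: lb_le_inf => // k [_ fk].
by rewrite ler_pdivrMr ?mdist_gt0.
Qed.

End Lip.

Section Ideal.
Context {R : realType} (I : banach_lip_ideal R).
Implicit Types (X Y : pmetricType R) (E F G : completeNormedModType R).

Let id_bounded E : bounded_linear (id : E -> E).
Proof. by apply: (@bounded_linearP _ _ _ _ 1) => // x; rewrite mul1r. Qed.

Lemma ideal_precomp X Y E (g : Y -> X) (f : X -> E) k :
  lip_bound g k -> g point = point -> ideal_mem I f ->
  ideal_mem I (f \o g) /\ ideal_norm I (f \o g) <= k * ideal_norm I f.
Proof.
move=> gk gp fI; have gL : Lip0 g by split => //; exists k.
have [] := (ideal_comp (BLin (id_bounded E)) gL fI,
  ideal_norm_comp (BLin (id_bounded E)) gL fI).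
rewrite -[_ \o f \o g]/(f \o g) => fgI fgn; split=> //.
have f0 := ideal_norm_ge0 fI.
have id1 : `|BLin (id_bounded E)| <= 1.
  by apply: blin_le => // x; rewrite mul1r.
rewrite (le_trans fgn)// -[leRHS]mulr1 ler_pM ?mulr_ge0 ?Lip_ge0//; last first.
  by rewrite ler_wpM2r// Lip_le.
by case: gL.
Qed.

Lemma ideal_postcomp X E F (f : X -> E) (S : blin E F) : ideal_mem I f ->
  ideal_mem I (S \o f) /\ ideal_norm I (S \o f) <= `|S| * ideal_norm I f.
Proof.
move=> fI; have idb : lip_bound (id : X -> X) 1.
  by split=> // x y; rewrite mul1r.
have idL : Lip0 (id : X -> X) by split => //; exists 1.
split; first exact: (ideal_comp S idL fI).
rewrite (le_trans (ideal_norm_comp S idL fI))// mulrC ler_wpM2l//.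
by rewrite ler_piMl ?ideal_norm_ge0// Lip_le.
Qed.

Lemma ideal_memD X E (f g : X -> E) :
  ideal_mem I f -> ideal_mem I g -> ideal_mem I (f + g).
Proof. by move=> fI gI; rewrite -[f]scale1r; exact: idealP. Qed.

Lemma ideal_memZ X E a (f : X -> E) : ideal_mem I f -> ideal_mem I (a *: f).
Proof. by move=> fI; rewrite -[_ *: _]addr0; exact/idealP/ideal0. Qed.

(** Such a map is a finite sum of maps supported at one point, and each of these factors through the
    real line as a Lipschitz indicator followed by [t |-> t *: v x]. *)
Lemma ideal_mem_finite X E (s : seq X) (v : X -> E) : uniq s ->
  (forall x, x \in s) -> v point = 0 -> ideal_mem I v.
Proof.
move=> us sX v0.
have -> : v = \sum_(x <- s) (fun z => (z == x)%:R *: v x).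
  apply/funext => z; rewrite fct_sumE (bigD1_seq z)//= eqxx scale1r.
  by rewrite big1 ?addr0// => x /negPf; rewrite eq_sym => ->; rewrite scale0r.
elim/big_ind : _ => [|f g|x _]; [exact: ideal0|exact: ideal_memD|].
have [->|xp] := eqVneq x point.
  rewrite v0 (_ : (fun=> _) = 0); first exact: ideal0.
  by apply/funext => z; rewrite scaler0.
have vl : linear (fun t : R => t *: v x).
  by move=> a t t'; rewrite scalerDl scalerA.
have vb t : `|t *: v x| <= `|v x| * `|t| by rewrite normrZ mulrC.
pose d (z : X) : normed_metric R := (z == x)%:R.
suff dL : Lip0 d.
  exact: (ideal_comp (BLin (bounded_linearP vl vb)) dL (ideal_id I)).
split; last by rewrite /d eq_sym (negPf xp).
(* A crude Lipschitz constant for the indicator of [x]: it dominates the inverse distance from [x]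
   to every other point. *)
pose k := \sum_(y <- s) (mdist x y)^-1.
have kdist y : y != x -> 1 <= k * mdist x y.
  move=> yx; rewrite -ler_pdivrMr ?mdist_gt0 1?eq_sym// mul1r.
  rewrite /k (bigD1_seq y)//= lerDl sumr_ge0// => i _.
  by rewrite invr_ge0 mdist_ge0.
exists k; split=> [|y z].
  by rewrite sumr_ge0// => i _; rewrite invr_ge0 mdist_ge0.
rewrite -[mdist (d y) _]/(`|(y == x)%:R - (z == x)%:R : R|).
have [->|yx] := eqVneq y x; have [->|zx] := eqVneq z x.
- by rewrite subrr normr0 mdistxx mulr0.
- by rewrite subr0 normr1 kdist.
- by rewrite sub0r normrN normr1 metric_sym kdist.
- rewrite subrr normr0 mulr_ge0 ?mdist_ge0// sumr_ge0// => i _.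
  by rewrite invr_ge0 mdist_ge0.
Qed.

End Ideal.

(** * Weak*-closedness of the balls of a maximal ideal *)

(** The matrix [phi] holds the values of [Phi] at the maps equal to [e j] at [x] and 0 elsewhere.
    Any coordinates [a] of [v] are allowed, which lets the same [phi] serve several maps. *)
Lemma functional_finite_sum (R : realType) (X : choiceType) (G : lmodType R)
    n (e : 'I_n -> G) (s : seq X) (Phi : (X -> G) -> R) :
  scalar Phi -> uniq s -> (forall x, x \in s) ->
  exists phi : X -> 'I_n -> R, forall (a : X -> 'I_n -> R) v,
    (forall x, v x = \sum_(j < n) a x j *: e j) ->
    Phi v = \sum_(x <- s) \sum_(j < n) a x j * phi x j.
Proof.
move=> Phil us sX.
have Phi0 := scalar_map0 Phil; have PhiD v w := scalar_mapD v w Phil.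
exists (fun x j => Phi (fun z => (z == x)%:R *: e j)) => a v va.
have -> : v = \sum_(x <- s) \sum_(j < n) a x j *: (fun z => (z == x)%:R *: e j).
  have termE x z : (\sum_(j < n) a x j *: (fun z => (z == x)%:R *: e j)) z =
      (z == x)%:R *: v x.
    rewrite fct_sumE va scaler_sumr; apply: eq_bigr => j _.
    by rewrite -[LHS]/(a x j *: (_ *: e j)) !scalerA mulrC.
  apply/funext => z; rewrite fct_sumE (bigD1_seq z)// termE eqxx scale1r.
  rewrite big1 => [|x xz]; first exact: esym (addr0 _).
  by rewrite termE eq_sym (negPf xz) scale0r.
rewrite (big_morph Phi PhiD Phi0); apply: eq_bigr => x _.
exact: scalar_map_sum.
Qed.

(* The dual of [l_infty^N(F)] is [l_1^N(F')]. *)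
Lemma functional_on_sup_product (R : realType) (F : normedModType R) N
    (K : R) (th : ('I_N -> F) -> R) :
  scalar th -> 0 <= K ->
  (forall b M, 0 <= M -> (forall i, `|b i| <= M) -> th b <= K * M) ->
  exists2 y : 'I_N -> blin F R, \sum_(i < N) `|y i| <= K &
    forall b, th b = \sum_(i < N) y i (b i).
Proof.
move=> thl K0 thK.
have th0 := scalar_map0 thl; have thD v w := scalar_mapD v w thl.
pose at_ i (x : F) : 'I_N -> F := fun k => if k == i then x else 0.
have yl i : linear (fun x => th (at_ i x) : R^o).
  move=> a x x'; rewrite -thl; congr th; apply/funext => k /=.
  rewrite /at_ -[RHS]/(a *: (if _ then _ else _) + (if _ then _ else _)).
  by case: ifP => // _; rewrite scaler0 addr0.
have yb i x : `|th (at_ i x)| <= K * `|x|.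
  have at_le z : `|z| = `|x| -> th (at_ i z) <= K * `|x|.
    move=> zx; apply: thK => // k; rewrite /at_; case: ifP => _.
      by rewrite zx.
    by rewrite normr0.
  have atN : th (at_ i (- x)) = - th (at_ i x).
    apply/eqP; rewrite -addr_eq0 -thD; apply/eqP; rewrite -[RHS]th0; congr th.
    apply/funext => k; rewrite -[LHS]/(at_ i (- x) k + at_ i x k) /at_.
    by case: ifP => _; rewrite ?addNr ?addr0.
  by rewrite ler_norml at_le// andbT lerNl -atN at_le// normrN.
pose y i : blin F R := BLin (bounded_linearP (yl i) (yb i)).
have thE b : th b = \sum_(i < N) y i (b i).
  rewrite [in LHS](_ : b = \sum_(i < N) at_ i (b i)).
    exact: (big_morph th thD th0).
  apply/funext => k; rewrite fct_sumE (bigD1 k)//= /at_ eqxx big1 ?addr0//.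
  by move=> i ik; rewrite eq_sym (negPf ik).
exists y => //; apply/ler_addgt0Pl => eps eps0.
have N1 : 0 < (N%:R + 1 : R) by rewrite ltr_wpDl.
(* Nearly norming vectors, taken in all coordinates at once, form a point of the unit ball at which
   to test [th]; the errors add up to at most [eps]. *)
have /choice[x xP] i :
    exists x, `|x| <= 1 /\ `|y i| - eps / (N%:R + 1) <= y i x.
  have [|x] := @blin_almost_norming _ _ (y i) (eps / (N%:R + 1)).
    by rewrite divr_gt0.
  by exists x.
have : \sum_(i < N) (`|y i| - eps / (N%:R + 1)) <= K.
  rewrite (le_trans (ler_sum _ (fun i _ => (xP i).2)))// -thE -[K]mulr1.
  by apply: thK => // i; exact: (xP i).1.
rewrite sumrB lerBlDr => /le_trans; apply; rewrite addrC lerD2r.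
rewrite sumr_const card_ord -[leLHS]mulr_natl mulrCA ler_piMr ?(ltW eps0)//.
by rewrite ler_pdivrMr// mul1r lerDl.
Qed.

Section WeakStar.
Context {R : realType} (I : banach_lip_ideal R).
Context {X : pmetricType R} {F : completeNormedModType R}.
Context {J : Type} {U : set_system J} {PU : ProperFilter U}.
Variables (k : J -> X -> dual F) (h : X -> dual F) (C : R).
Hypothesis kI : forall a, ideal_mem I (k a).
Hypothesis kC : forall a, ideal_norm I (k a) <= C.
Hypothesis kh : forall x y,
  (k a x : blin F R) y @[a --> U] --> (h x : blin F R) y.

Lemma weakstar_bound_ge0 : 0 <= C.
Proof.
have [a _] := @filter_ex _ U _ _ filterT.
exact: le_trans (ideal_norm_ge0 (kI a)) (kC a).
Qed.

Lemma weakstar_limit_point : h point = 0.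
Proof.
apply/val_inj/funext => y.
have kp : (fun a => (k a point : blin F R) y) = fun=> 0.
  by apply/funext => a; have [_ ->] := ideal_Lip0 (kI a).
have := @kh point y; rewrite kp => k0.
exact: cvg_unique k0 (cvg_cst _).
Qed.

(** Hahn-Banach gives [Phi] attaining the norm of [Q \o h]. For weak*-continuous [q], [kC] bounds
    [Phi (q \o h)]; a second extension represents these values by functionals [y i] on [F], to which
    the arbitrary [Q] can be applied. *)
Lemma weakstar_quotient_norm (G : completeNormedModType R) n (e : 'I_n -> G)
    (Q : blin (dual F) G) (s : seq X) :
  (forall v, exists c : 'I_n -> R, v = \sum_(i < n) c i *: e i) ->
  (forall y, `|Q y| <= `|y|) -> uniq s -> (forall x, x \in s) ->
  ideal_norm I (Q \o h) <= C.
Proof.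
move=> en Q1 us sX; have C0 := weakstar_bound_ge0.
have {n e en}[n [e [c [cl ce ebfree]]]] := finite_basis en.
(* Subtracting the value at the distinguished point turns the ideal norm into a seminorm on all maps
   [X -> G]. *)
pose p (v : X -> G) := ideal_norm I (v - cst (v point)).
have pI (v : X -> G) : ideal_mem I (v - cst (v point)).
  apply: (@ideal_mem_finite R I X G s _ us sX).
  by rewrite -[LHS]/(v point - v point) subrr.
have p0 (v : X -> G) : v point = 0 -> p v = ideal_norm I v.
  by move=> v0; rewrite /p v0 (_ : cst 0 = 0) ?subr0.
have Qh0 : Q (h point) = 0 by rewrite weakstar_limit_point linear0.
have [|||||Phi [Phil Phip PhiQ]] := @hahn_banach R (X -> G) p _ _ R^o
    (fun t => t *: (Q \o h)) (fun t => t * ideal_norm I (Q \o h)).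
- move=> a v a0; rewrite /p -(gtr0_norm a0) -ideal_normZ//; congr ideal_norm.
  by rewrite scalerBr gtr0_norm.
- move=> v w; rewrite /p (le_trans _ (ideal_normD (pI v) (pI w)))//.
  by rewrite addrACA -opprD.
- by move=> a t t'; rewrite scalerDl scalerA.
- by move=> a t t'; rewrite mulrDl mulrA.
- have QhI : ideal_mem I (Q \o h).
    exact: (@ideal_mem_finite R I X G s _ us sX).
  move=> t; rewrite p0; last by rewrite -[LHS]/(t *: Q (h point)) Qh0 scaler0.
  by rewrite ideal_normZ// ler_wpM2r ?ler_norm// ideal_norm_ge0.
have {}PhiQ : Phi (Q \o h) = ideal_norm I (Q \o h).
  by have := PhiQ 1; rewrite scale1r mul1r.
have [phi PhiE] := functional_finite_sum e Phil us sX.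
rewrite -PhiQ; apply/ler_addgt0Pl => eps eps0.
have C1 : 0 < C + 1 by rewrite ltr_wpDl.
(* This tolerance turns the factor on [C] into an additive error of at most [eps]. *)
have [t [t1 tn]] := finite_norming ce ebfree (divr_gt0 eps0 C1).
set d := eps / (C + 1) in tn.
suff : Phi (Q \o h) <= (1 + d) * C.
  move=> /le_trans; apply; rewrite mulrDl mul1r addrC lerD2r.
  rewrite /d mulrAC -mulrA ler_piMr ?(ltW eps0)// ler_pdivrMr// mul1r.
  by rewrite lerDl.
have d0 : 0 < d by exact: divr_gt0.
have d1 : 0 < 1 + d by rewrite addr_gt0.
set K := (1 + d) * C; have K0 : 0 <= K by rewrite mulr_ge0// ltW.
pose N := size t; pose g (i : 'I_N) : blin G R := nth 0 t i.
(* For the operator [q] that [a] defines below, [g i (q y) = y (b a i)], so [b a] controls the norm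
   of [q]. *)
pose b (a : 'I_n -> F) (i : 'I_N) : F := \sum_(j < n) g i (e j) *: a j.
(* Weak*-continuous operators, through which the bounds [kC] pass to [h]. *)
have ql (a : 'I_n -> F) :
    linear (fun y : dual F => \sum_(j < n) (y : blin F R) (a j) *: e j).
  move=> m y y'; rewrite scaler_sumr -big_split/=; apply: eq_bigr => j _.
  by rewrite scalerA -scalerDl.
have qM (a : 'I_n -> F) (M : R) (y : dual F) : 0 <= M ->
    (forall i, `|b a i| <= M) ->
    `|\sum_(j < n) (y : blin F R) (a j) *: e j| <= (1 + d) * M * `|y|.
  move=> M0 bM; set v := \sum_(j < n) _.
  have [->|/tn[_ /(nthP 0)[i it <-]]] := eqVneq v 0.
    by rewrite normr0 !mulr_ge0// ltW.
  move=> /ltW/le_trans; apply; rewrite -mulrA ler_wpM2l ?(ltW d1)//.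
  rewrite -/(g (Ordinal it)) /v linear_sum/=.
  have -> : \sum_(j < n) g (Ordinal it) ((y : blin F R) (a j) *: e j) =
      (y : blin F R) (b a (Ordinal it)).
    rewrite linear_sum/=; apply: eq_bigr => j _.
    by rewrite !linearZ; exact: mulrC.
  rewrite (le_trans (ler_norm _))// (le_trans (blin_ub y _))// mulrC.
  by rewrite ler_wpM2r.
pose bmax (B : 'I_N -> F) := \big[Order.max/0]_(i < N) `|B i|.
have bmax0 B : 0 <= bmax B by exact: bigmax_ge_id.
have bmaxP B i : `|B i| <= bmax B by exact: le_bigmax.
have bmax_le B M : 0 <= M -> (forall i, `|B i| <= M) -> bmax B <= M.
  by move=> M0 BM; apply: bigmax_le.
(* [u a] is [Phi (q \o h)]; as a finite sum of evaluations it is the limit of the values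
   [Phi (q \o k i)]. *)
pose u (a : 'I_n -> F) :=
  \sum_(x <- s) \sum_(j < n) (h x : blin F R) (a j) * phi x j.
have u_le (a : 'I_n -> F) : u a <= K * bmax (b a).
  have qb := qM a _ _ (bmax0 (b a)) (bmaxP _).
  pose q := BLin (bounded_linearP (ql a) qb).
  have q_le : `|q| <= (1 + d) * bmax (b a).
    by apply: blin_le => //; rewrite mulr_ge0// ltW.
  have ku : \sum_(x <- s) \sum_(j < n) (k i x : blin F R) (a j) * phi x j
      @[i --> U] --> u a.
    apply: (@cvg_sum _ R^o) => x; apply: (@cvg_sum _ R^o) => j.
    by apply: cvgMr_tmp; exact: kh.
  apply: (cvgr_to_le ku); apply: nearW => i.
  have [qkI qkC] := ideal_postcomp q (kI i).
  rewrite -(PhiE _ (q \o k i))// (le_trans (Phip _))// p0; last first.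
    by have [_ kp] := ideal_Lip0 (kI i); rewrite /= kp; exact: (linear0 q).
  rewrite (le_trans qkC)// /K mulrAC ler_pM// ideal_norm_ge0//.
(* By [u_le], [u] factors through [b]; it is extended from the image of [b] to [l_infty^N(F)]. *)
have [|||||th [thl thp thb]] := @hahn_banach R ('I_N -> F)
    (fun B => K * bmax B) _ _ ('I_n -> F) b u.
- move=> a B a0; rewrite mulrCA; congr (_ * _).
  rewrite /bmax (big_morph _ (fun x y => maxr_pMr x y (ltW a0)) (mulr0 a)).
  by apply: eq_bigr => i _; rewrite -(gtr0_norm a0) -normrZ gtr0_norm.
- move=> B B'; rewrite -mulrDr ler_wpM2l//; apply: bmax_le => [|i].
    by rewrite addr_ge0.
  by rewrite (le_trans (ler_normD _ _))// lerD.
- move=> m a a'; apply/funext => i.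
  rewrite -[RHS]/(m *: b a i + b a' i) /b scaler_sumr -big_split/=.
  by apply: eq_bigr => j _; rewrite scalerDr !scalerA mulrC.
- move=> m a a'; rewrite /u mulr_sumr -big_split/=; apply: eq_bigr => x _.
  rewrite mulr_sumr -big_split/=; apply: eq_bigr => j _.
  by rewrite mulrA -mulrDl blin_linear.
- exact: u_le.
have [|y yK thy] := functional_on_sup_product thl K0.
  by move=> B M M0 BM; rewrite (le_trans (thp B))// ler_wpM2l// bmax_le.
(* Evaluate [u] at the tuple with [z] in position [j] and 0 elsewhere, computing it once from [phi]
   and once from the [y i]. *)
have hy j : \sum_(x <- s) phi x j *: h x = \sum_(i < N) g i (e j) *: y i.
  apply/val_inj/funext => z.
  pose a l := if l == j then z else 0.
  have uE : u a = \sum_(x <- s) phi x j * (h x : blin F R) z.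
    apply: eq_bigr => x _; rewrite (bigD1 j)//= /a eqxx big1 ?addr0 1?mulrC//.
    by move=> l /negPf lj; rewrite lj linear0 mul0r.
  have bE i : b a i = g i (e j) *: z.
    rewrite /b (bigD1 j)//= /a eqxx big1 ?addr0//.
    by move=> l /negPf lj; rewrite lj scaler0.
  rewrite /= !blin_sumE -[LHS]uE -thb thy; apply: eq_bigr => i _.
  by rewrite bE linearZ.
(* [hy] is an identity between elements of the dual of [F], so any linear [Q] may be applied to it,
   coordinate by coordinate. *)
have -> : Phi (Q \o h) = \sum_(i < N) g i (Q (y i)).
  rewrite (PhiE (fun x => c (Q (h x)))); last by move=> x; exact: ce.
  rewrite exchange_big/=.
  have cQ j : scalar (fun w => c (Q w) j).
    by move=> m w w'; rewrite blin_linear cl.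
  transitivity (\sum_(j < n) \sum_(i < N) g i (e j) * c (Q (y i)) j).
    apply: eq_bigr => j _; rewrite -(scalar_map_sum _ _ _ (cQ j)) -hy.
    rewrite (scalar_map_sum _ _ _ (cQ j)).
    by apply: eq_bigr => x _; rewrite mulrC.
  rewrite exchange_big/=; apply: eq_bigr => i _.
  rewrite [in RHS](ce (Q (y i))) linear_sum/=; apply: eq_bigr => j _.
  by rewrite linearZ/= mulrC.
rewrite (le_trans _ yK)//; apply: ler_sum => i _.
rewrite (le_trans (ler_norm _))// (le_trans (blin_ub _ _))//.
by rewrite (le_trans _ (Q1 _))// ler_piMl// t1// mem_nth.
Qed.

End WeakStar.

Lemma normed_mdistE (R : realType) (E : normedModType R) (x y : E) :
  mdist (x : normed_metric E) (y : normed_metric E) = `|x - y|.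
Proof. by []. Qed.

Lemma bquot_pi_bounded (R : realType) (E : normedModType R)
  (M : closed_subspace E) : bounded_linear (@bquot_pi R E M).
Proof.
apply: (@bounded_linearP _ _ _ _ 1); first exact: bquot_pi_linear.
by move=> x; rewrite mul1r; exact: bquot_norm_le.
Qed.

Lemma ideal_dist_le (R : realType) (I : banach_lip_ideal R) (X : pmetricType R)
    (E : completeNormedModType R) (f : X -> E) (C : R) : ideal_mem I f ->
  ideal_norm I f <= C -> forall x x', `|f x - f x'| <= C * mdist x x'.
Proof.
move=> fI fC x x'; have [fL _] := ideal_Lip0 fI.
have [_ /(_ x x')] := Lip_bound fL; rewrite normed_mdistE.
move=> /le_trans; apply; rewrite ler_wpM2r ?mdist_ge0//.
exact: le_trans (ideal_Lip_le fI) fC.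
Qed.

(* The quotient maps of [F'] need not be weak*-continuous, hence the detour
   through [weakstar_quotient_norm]. *)
Lemma weakstar_closed (R : realType) (I : banach_lip_ideal R)
    (X : pmetricType R) (F : completeNormedModType R) (J : Type)
    (U : set_system J) {PU : ProperFilter U} (k : J -> X -> dual F)
    (h : X -> dual F) (C : R) :
  maximal_ideal I ->
  (forall a, ideal_mem I (k a)) -> (forall a, ideal_norm I (k a) <= C) ->
  (forall x y, (k a x : blin F R) y @[a --> U] --> (h x : blin F R) y) ->
  ideal_mem I h /\ ideal_norm I h <= C.
Proof.
move=> Imax kI kC kh; have C0 := weakstar_bound_ge0 (PU := PU) kI kC.
(* The restrictions of the [k a] to a finite subspace keep the bound [C], so the previous lemma
   applies there to each quotient map. *)
have h_le : (max_norm I h <= C%:E)%E.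
  apply: ge_ereal_sup => _ [X0 [X0pt [M [X0fin Mcod ->]]]].
  rewrite lee_fin.
  have [n [e en]] := Mcod.
  have /finite_seqP[s0 s0E] := X0fin.
  pose s := undup (pmap insub s0 : seq (metric_sub X0pt)).
  have us : uniq s by exact: undup_uniq.
  have sX x : x \in s.
    rewrite mem_undup mem_pmap; apply/mapP.
    exists (val x); last by rewrite valK.
    suff : [set` s0] (val x) by [].
    by rewrite -s0E; exact: set_mem (valP x).
  have iota_lip : lip_bound (Defs.incl (A0 := X0pt)) 1.
    by split => // x y; rewrite mul1r.
  have kiI a := ideal_precomp iota_lip erefl (kI a).
  pose Q : blin (dual F) (bquot M) := BLin (bquot_pi_bounded M).
  apply: (weakstar_quotient_norm (PU := PU)
    (k := fun a => k a \o Defs.incl (A0 := X0pt)) (Q := Q) _ _ _ en _ us sX).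
  - by move=> a; have [] := kiI a.
  - by move=> a; have [_] := kiI a; rewrite mul1r => /le_trans; apply.
  - by move=> x y; exact: kh.
  - by move=> y; exact: bquot_norm_le.
have hI : ideal_mem I h.
  apply/(Imax _ _ h).1; split; last exact: le_lt_trans h_le (ltry _).
  split; last exact: (weakstar_limit_point (PU := PU) kI kh).
  (* The maximal hull also asks for a Lipschitz map: [C] is a common Lipschitz constant of the [k a]
     and survives pointwise limits. *)
  exists C; split=> // x x'; rewrite normed_mdistE.
  apply: blin_le => [|y]; first by rewrite mulr_ge0 ?mdist_ge0.
  have kxx' : `|(k a x : blin F R) y - (k a x' : blin F R) y| @[a --> U] -->
      `|(h x : blin F R) y - (h x' : blin F R) y|.
    by apply: (@cvg_norm _ R^o); apply: (@cvgB _ R^o); exact: kh.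
  apply: (cvgr_to_le kxx'); apply: nearW => a.
  rewrite (le_trans (blin_ub (k a x - k a x' : blin F R) y))//.
  by rewrite ler_wpM2r//; exact: ideal_dist_le (kI a) (kC a) x x'.
by split => //; rewrite -lee_fin (Imax _ _ h).2.
Qed.

(** * Invariant means *)

(** Compactness of [[-M, M]] gives a cluster point, and an ultrafilter converges to its cluster
    points. *)
Lemma ultra_bounded_cvg (R : realType) (J : Type) (U : set_system J)
    (u : J -> R) (M : R) : UltraFilter U -> (forall a, `|u a| <= M) ->
  exists l : R, u @ U --> l.
Proof.
move=> UU uM.
have [|l [_ ul]] := @segment_compact R (- M) M (u @ U) _.
  by apply: nearW => a; rewrite /= in_itv/= -ler_norml.
exists l => B Bl; have [//|UB] := in_ultra_setVsetC (u @^-1` B) UU.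
by have [x []] := ul (~` B) B UB Bl.
Qed.

Lemma banach_alaoglu (R : realType) (F : normedModType R) (J : Type)
    (U : set_system J) (m : J -> blin F R) (M : R) :
  UltraFilter U -> (forall a, `|m a| <= M) ->
  exists H : blin F R, forall y, m a y @[a --> U] --> H y.
Proof.
move=> UU mM.
have mb a y : `|m a y| <= M * `|y|.
  by rewrite (le_trans (blin_ub _ _))// ler_wpM2r.
have /choice[H mH] y : exists l : R, m a y @[a --> U] --> l.
  by apply: ultra_bounded_cvg => a; exact: mb.
have Hl : linear (H : F -> R^o).
  move=> t y y'; have := @mH (t *: y + y').
  under eq_fun do rewrite blin_linear.
  move=> mH1; apply: cvg_unique mH1 _ => //.
  by apply: (@cvgD _ R^o); [exact: (@cvgZl_tmp _ R^o)|exact: mH].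
have Hb y : `|H y| <= M * `|y|.
  by apply: (cvgr_to_le (@cvg_norm _ R^o _ _ _ _ _ (mH y))); exact: nearW.
by exists (BLin (bounded_linearP Hl Hb)).
Qed.

(* The average of [phi] over the box [{\sum_i k_i d_i | 0 <= k_i <= n}],
   counted with multiplicity. *)
Fixpoint box_avg (R : realType) (V : lmodType R) (D : zmodType) (n : nat)
    (s : seq D) (phi : D -> V) : V :=
  if s is d :: s' then
    n.+1%:R^-1 *: \sum_(i < n.+1) box_avg n s' (fun x => phi (x + d *+ i))
  else phi 0.

Section BoxAvg.
Context {R : realType} {D : zmodType} (n : nat).
Implicit Types (s : seq D) (d : D).

Lemma box_avg_linear (V W : lmodType R) (f : {linear V -> W}) s (phi : D -> V) :
  f (box_avg n s phi) = box_avg n s (f \o phi).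
Proof.
elim: s phi => [//|d s IHs] phi /=.
by rewrite linearZ linear_sum/=; under eq_bigr do rewrite IHs.
Qed.

Lemma box_avgD (V : lmodType R) s (phi psi : D -> V) :
  box_avg n s (fun x => phi x + psi x) = box_avg n s phi + box_avg n s psi.
Proof.
elim: s phi psi => [//|d s IHs] phi psi /=.
by rewrite -scalerDr -big_split/=; under eq_bigr do rewrite IHs.
Qed.

Lemma box_avg_cst (V : lmodType R) s (v : V) : box_avg n s (fun=> v) = v.
Proof.
elim: s => [//|d s IHs] /=; under eq_bigr do rewrite IHs.
rewrite sumr_const card_ord -[v *+ _]scaler_nat scalerA.
by rewrite mulVf ?scale1r ?pnatr_eq0.
Qed.

Lemma box_avg_le (phi : D -> R) (M : R) s :
  (forall x, `|phi x| <= M) -> `|box_avg n s (phi : D -> R^o)| <= M.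
Proof.
elim: s phi => [|d s IHs] phi phiM; first exact: phiM.
rewrite normrZ gtr0_norm ?invr_gt0// ler_pdivrMl//.
rewrite (le_trans (ler_norm_sum _ _ _))//.
rewrite (@le_trans _ _ (\sum_(i < n.+1) M))//; last first.
  by rewrite sumr_const card_ord mulr_natl.
by apply: ler_sum => i _; apply: (IHs (fun x => phi (x + d *+ i))).
Qed.

(* In the direction of one of its sides, the shifted box differs from the box
   by two opposite faces, that is by a proportion 2/(n+1) of its points. *)
Lemma box_avg_shift (phi : D -> R) (M : R) s d :
  (forall x, `|phi x| <= M) -> d \in s ->
  `|box_avg n s ((fun x => phi (x + d)) : D -> R^o) -
    box_avg n s (phi : D -> R^o)| <= 2 * M / n.+1%:R.
Proof.
elim: s phi => [//|e s IHs] phi phiM; rewrite inE /= -scalerBr.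
move=> /orP[/eqP <-{e}|ds].
  rewrite -sumrB.
  under eq_bigr => i _.
    rewrite (_ : (fun x => phi (x + d *+ i + d)) =
      (fun x => phi (x + d *+ i.+1))); last first.
      by apply/funext => x; rewrite mulrSr addrA.
    over.
  rewrite -(big_mkord xpredT (fun i =>
    box_avg n s ((fun x => phi (x + d *+ i.+1)) : D -> R^o) -
    box_avg n s ((fun x => phi (x + d *+ i)) : D -> R^o))) telescope_sumr//.
  rewrite normrZ gtr0_norm ?invr_gt0// mulrC ler_wpM2r ?invr_ge0//.
  by rewrite (le_trans (ler_normB _ _))// mulr_natl mulr2n lerD// box_avg_le.
rewrite -sumrB normrZ gtr0_norm ?invr_gt0// ler_pdivrMl//.
rewrite (le_trans (ler_norm_sum _ _ _))//.
rewrite (@le_trans _ _ (\sum_(i < n.+1) (2 * M / n.+1%:R)))//; last first.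
  by rewrite sumr_const card_ord -[leLHS]mulr_natl.
apply: ler_sum => i _.
rewrite (_ : (fun x => phi (x + e *+ i + d)) =
  (fun x => phi (x + d + e *+ i))); last by apply/funext => x; rewrite addrAC.
exact: (IHs (fun x => phi (x + e *+ i))).
Qed.

End BoxAvg.

(** [U] refines the filter along which [s] absorbs every finite list and [n] tends to infinity; once
    [d] is in [s], [box_avg_shift] bounds the difference by [2 * M / n.+1%:R]. *)
Lemma invariant_mean (R : realType) (D : zmodType) :
  exists2 U : set_system (seq D * nat), UltraFilter U &
    forall (phi : D -> R) (M : R) d, (forall x, `|phi x| <= M) ->
    box_avg p.2 p.1 ((fun x => phi (x + d)) : D -> R^o) -
      box_avg p.2 p.1 (phi : D -> R^o) @[p --> U] --> (0 : R).
Proof.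
pose F0 := filter_from setT
  (fun t : seq D => [set s : seq D | {subset t <= s}]).
have F0F : ProperFilter F0.
  apply: filter_from_proper => [|t _]; last by exists t => x.
  apply: filter_from_filter => [|t t' _ _]; first by exists [::].
  exists (t ++ t') => // s st.
  by split=> x xt; apply: st; rewrite mem_cat xt ?orbT.
have F0N : ProperFilter (filter_prod F0 (\oo : set_system nat)).
  exact: filter_prod_proper.
have [U [UU FU]] := ultraFilterLemma F0N.
exists U => // phi M d phiM.
have M0 : 0 <= M by exact: le_trans (normr_ge0 _) (phiM 0).
apply/cvgrPdist_le => e e0; apply: FU.
(* The [+ 1] covers the case [M = 0]. *)
have e'0 : 0 < e / (2 * M + 1) by rewrite divr_gt0// ltr_wpDl// mulr_ge0.
exists ([set s | d \in s], [set n | n.+1%:R^-1 < e / (2 * M + 1)]); first split.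
- by exists [:: d] => // s /(_ d); rewrite inE eqxx; exact.
- exact: (near_infty_natSinv_lt (PosNum e'0)).
move=> [s n] [/= ds ne]; rewrite sub0r normrN.
rewrite (le_trans (box_avg_shift n phiM ds))//.
rewrite (le_trans (ler_wpM2l _ (ltW ne))) ?mulr_ge0//.
by rewrite mulrCA ger_pMr// ler_pdivrMr ?mul1r ?lerDl// ltr_wpDl// mulr_ge0.
Qed.

(** * Translates of ideal members and their averages *)

Section Translations.
Context {R : realType} (I : banach_lip_ideal R).
Context {Z F : completeNormedModType R}.

(** Invariance concerns subsets, so the whole space is treated as the subset [setT]; the passages to
    it and back from its translate are 1-Lipschitz and preserve 0. *)
Lemma translation_mem (h : normed_metric Z -> F) (w : Z) :
  translation_invariant I -> ideal_mem I h ->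
  let hw : normed_metric Z -> F := fun z => h (z + w :> Z) - h w in
  ideal_mem I hw /\ ideal_norm I hw <= ideal_norm I h.
Proof.
move=> Itrans hI hw.
have inclb : lip_bound (@Defs.incl _ _ _ _ :
    banach_sub (X := [set: Z]) Logic.I -> normed_metric Z) 1.
  by split => // x y; rewrite mul1r.
have [hiI hin] := ideal_precomp inclb erefl hI.
have [mem_eq norm_eq] := @Itrans Z F setT Logic.I w Logic.I _ (ideal_Lip0 hiI).
move: mem_eq norm_eq; set fx0 := translate_map _ _ => mem_eq norm_eq.
have tP (z : Z) : z \in translate_set [set: Z] w.
  by apply/mem_set; exists (z + w); rewrite ?addrK.
pose t (z : normed_metric Z) :
  banach_sub (translate_set0 (Logic.I : [set: Z] w)) := exist _ z (tP z).
have tb : lip_bound t 1 by split => // x y; rewrite mul1r.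
have tp : t point = point by exact: val_inj.
have [htI htn] := ideal_precomp tb tp (mem_eq.1 hiI).
suff -> : hw = fx0 \o t.
  split=> //; rewrite (le_trans htn)// mul1r -norm_eq// (le_trans hin)//.
  by rewrite mul1r.
by apply/funext => z.
Qed.

End Translations.

Lemma ideal_mem_box_avg (R : realType) (I : banach_lip_ideal R)
    (X : pmetricType R) (E : completeNormedModType R) (D : zmodType) n
    (s : seq D) (phi : D -> X -> E) (C : R) :
  (forall d, ideal_mem I (phi d)) -> (forall d, ideal_norm I (phi d) <= C) ->
  ideal_mem I (box_avg n s phi) /\ ideal_norm I (box_avg n s phi) <= C.
Proof.
elim: s phi => [|d s IHs] phi phiI phiC.
  by split; [exact: phiI|exact: phiC].
have {}IHs i := IHs (fun x => phi (x + d *+ i)) (fun=> phiI _) (fun=> phiC _).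
set S := \sum_(i < n.+1) box_avg n s (fun x => phi (x + d *+ i)).
have [sumI sumC] : ideal_mem I S /\ ideal_norm I S <= C *+ n.+1.
  rewrite -[X in C *+ X]card_ord -sumr_const.
  have norm0 : ideal_norm I (0 : X -> E) = 0.
    rewrite -(scale0r (0 : X -> E)) ideal_normZ ?normr0 ?mul0r//.
    exact: ideal0.
  rewrite /S; elim/big_rec2 : _ => [|i M f _ [fI fC]].
    by rewrite norm0; split=> //; exact: ideal0.
  have [iI iC] := IHs i; split; first exact: ideal_memD.
  by rewrite (le_trans (ideal_normD iI fI))// lerD.
split; first exact: ideal_memZ.
rewrite /= ideal_normZ// gtr0_norm ?invr_gt0// ler_pdivrMl//.
by rewrite mulr_natl.
Qed.

(** [H] is the weak* limit of box averages of the translates [hw d], and [weakstar_closed] keeps it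
    in the ideal. Where all translates agree with [h], averaging changes nothing. *)
Lemma ideal_invariant_average (R : realType) (I : banach_lip_ideal R)
    (Z F : completeNormedModType R) (D : zmodType) (j : {additive D -> Z})
    (h : normed_metric Z -> dual F) :
  maximal_ideal I -> translation_invariant I -> ideal_mem I h ->
  exists H : normed_metric Z -> dual F,
    [/\ ideal_mem I H, ideal_norm I H <= ideal_norm I h,
        forall (z : Z) d, H (z + j d) = H z + H (j d) &
        forall x : Z, (forall d, h (x + j d) - h (j d) = h x) -> H x = h x].
Proof.
move=> Imax Itrans hI; set C := ideal_norm I h.
have [U UU mean] := invariant_mean R D.
pose hw d : normed_metric Z -> dual F := fun z => h (z + j d : Z) - h (j d).
have hwI d := translation_mem (j d) Itrans hI.
pose k (p : seq D * nat) := box_avg p.2 p.1 hw.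
have kI p : ideal_mem I (k p) /\ ideal_norm I (k p) <= C.
  by apply: ideal_mem_box_avg => d; have [] := hwI d.
pose ev z y (v : normed_metric Z -> dual F) : R^o := (v z : blin F R) y.
have ev_linear z y : linear (ev z y) by [].
pose evl z y : {linear (normed_metric Z -> dual F) -> R^o} :=
  HB.pack (ev z y) (GRing.isLinear.Build _ _ _ _ _ (ev_linear z y)).
have kE p z y : (k p z : blin F R) y =
    box_avg p.2 p.1 (fun d => (hw d z : blin F R) y : R^o).
  exact: (box_avg_linear _ (evl z y)).
have hw_le d z y : `|(hw d z : blin F R) y| <= C * `|z : Z| * `|y|.
  rewrite (le_trans (blin_ub _ _))// ler_wpM2r//.
  rewrite (le_trans (ideal_dist_le hI (lexx _) (z + j d : Z) (j d : Z)))//.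
  by rewrite normed_mdistE addrK.
have /choice[H kH] (z : normed_metric Z) : exists H : dual F,
    forall y, (k p z : blin F R) y @[p --> U] --> (H : blin F R) y.
  apply: (@banach_alaoglu _ _ _ _ _ (C * `|z : Z|) UU) => p.
  apply: blin_le => [|y].
    by rewrite mulr_ge0// ideal_norm_ge0.
  by rewrite kE; apply: box_avg_le => d; exact: hw_le.
have [HI HC] := weakstar_closed Imax (fun p => (kI p).1) (fun p => (kI p).2) kH.
exists H; split=> // [z d|x hx].
  apply/val_inj/funext => y; apply: cvg_unique (@kH _ y) _ => //.
  pose phi d' : R := (hw d' z : blin F R) y.
  (* The cocycle identity [hw d' (z + j d) = hw (d' + d) z + hw d' (j d)], averaged over [d'];
     invariance of the mean makes the shift by [d] vanish in the limit. *)
  have kzd p : (k p (z + j d : Z) : blin F R) y =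
      (box_avg p.2 p.1 ((fun d' => phi (d' + d)) : D -> R^o) -
       box_avg p.2 p.1 (phi : D -> R^o)) +
      ((k p z : blin F R) y + (k p (j d) : blin F R) y).
    rewrite !kE addrA subrK -box_avgD; congr box_avg; apply/funext => d'.
    rewrite -[LHS]/((h (z + j d + j d' : Z) : blin F R) y -
      (h (j d') : blin F R) y).
    rewrite -[RHS]/(((h (z + j (d' + d) : Z) : blin F R) y -
      (h (j (d' + d)) : blin F R) y) +
      ((h (j d + j d' : Z) : blin F R) y - (h (j d') : blin F R) y)).
    have -> : (z : Z) + j d + j d' = (z : Z) + j (d' + d).
      by rewrite raddfD -addrA [j d + _]addrC.
    by rewrite [j d + j d']addrC -raddfD addrA subrK.
  suff : (fun p => (k p (z + j d : Z) : blin F R) y) @ U -->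
      (H z : blin F R) y + (H (j d) : blin F R) y by [].
  rewrite (funext kzd) -[X in _ --> X]add0r; apply: (@cvgD _ R^o).
    exact: (mean phi _ d (fun d' => hw_le d' z y)).
  by apply: (@cvgD _ R^o); exact: kH.
apply/val_inj/funext => y; apply: cvg_unique (@kH _ y) _ => //.
have -> : (fun p => (k p x : blin F R) y) = fun=> (h x : blin F R) y.
  apply/funext => p; rewrite kE -[RHS](box_avg_cst p.2 p.1 (_ : R^o)).
  by congr box_avg; apply/funext => d; rewrite /hw hx.
exact: cvg_cst.
Qed.

(** Additivity gives integer homogeneity. For [a >= 0], [n] times the defect [f (a *: x) - a *: f x]
    has the norm of the defect at the fractional part of [n * a], which is bounded uniformly in [n];
    hence the defect is 0. *)
Lemma additive_bounded_linear (R : realType) (V W : normedModType R)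
    (f : V -> W) (C : R) :
  (forall x y, f (x + y) = f x + f y) -> (forall x, `|f x| <= C * `|x|) ->
  linear f.
Proof.
move=> fD fC.
have f0 : f 0 = 0 by apply/(addrI (f 0)); rewrite -fD !addr0.
have fMn x m : f (x *+ m) = f x *+ m.
  by elim: m => [|m IHm]; rewrite ?mulr0n// !mulrS fD IHm.
have fN x : f (- x) = - f x by apply/eqP; rewrite -addr_eq0 -fD addNr f0.
suff fZ a x : 0 <= a -> f (a *: x) = a *: f x.
  move=> a x y; rewrite fD; congr (_ + _); have [/fZ//|a0] := leP 0 a.
  by rewrite -[a]opprK scaleNr fN fZ ?oppr_ge0 ?(ltW a0)// -scaleNr.
move=> a0; apply/eqP; rewrite -subr_eq0 -normr_le0.
have fn n : n%:R * `|f (a *: x) - a *: f x| <= 2 * (C * `|x|).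
  pose m := Num.truncn (n%:R * a).
  have na0 : 0 <= n%:R * a by rewrite mulr_ge0.
  have /andP[ma am] := truncn_itv na0.
  have d1 : `|n%:R * a - m%:R| <= 1.
    by rewrite ger0_norm ?subr_ge0// lerBlDr addrC natr1 ltW.
  set c := n%:R * a - m%:R in d1.
  have nac : n%:R * a = m%:R + c by rewrite addrC subrK.
  have -> : n%:R * `|f (a *: x) - a *: f x| = `|f (c *: x) - c *: f x|.
    rewrite -[X in X * _]ger0_norm// -normrZ; congr `|_|.
    rewrite scalerBr scaler_nat -fMn -scaler_nat !scalerA nac !scalerDl fD.
    by rewrite scaler_nat fMn -[f x *+ m]scaler_nat opprD addrACA subrr add0r.
  rewrite (le_trans (ler_normB _ _))// mulr_natl mulr2n lerD//.
    rewrite (le_trans (fC _))// normrZ mulrCA ler_piMl//.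
    exact: le_trans (fC x).
  by rewrite normrZ (le_trans (ler_piMl _ d1)).
rewrite leNgt; apply/negP => y0.
have Cx0 : 0 <= C * `|x| := le_trans (normr_ge0 _) (fC x).
have := archi_boundP (_ : 0 <= 2 * (C * `|x|) / `|f (a *: x) - a *: f x|).
rewrite divr_ge0 ?(mulr_ge0 _ Cx0)// => /(_ isT).
by rewrite ltr_pdivrMr// ltNge fn.
Qed.

(** * Extension of Lipschitz maps *)

(** McShane's infimum formula in each coordinate [s]. Comparison with the distinguished point bounds
    the infimum below and makes the extension bounded in [s]. *)
Lemma mcshane (R : realType) (X : pmetricType R) (Y : metricType R) (S : Type)
    (j : X -> Y) (f : X -> linfty R S) (L : R) :
  (forall x x', mdist x x' <= mdist (j x) (j x')) ->
  0 <= L -> (forall x x', `|f x - f x'| <= L * mdist x x') ->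
  exists2 h : Y -> linfty R S, forall x, h (j x) = f x &
    forall y y', `|h y - h y'| <= L * mdist y y'.
Proof.
move=> jX L0 fL.
pose A y s := range (fun x => f x s + L * mdist y (j x)).
have fs x x' s : f x s <= f x' s + L * mdist x x'.
  rewrite -lerBlDl (le_trans (ler_norm _))// (le_trans _ (fL x x'))//.
  exact: (supnorm_ub (f x - f x') s).
have Alb y s : lbound (A y s) (f point s - L * mdist y (j point)).
  move=> _ [x _ <-]; rewrite lerBlDr (le_trans (fs point x s))// -addrA lerD2l.
  rewrite -mulrDr ler_wpM2l// (le_trans (jX _ _))// addrC.
  by rewrite [mdist y (j point)]metric_sym metric_triangle.
have Ainf y s : has_inf (A y s).
  split; last by eexists; exact: Alb.
  by exists (f point s + L * mdist y (j point)), point.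
pose g y s := inf (A y s).
have gL y y' s : g y s <= g y' s + L * mdist y y'.
  rewrite -lerBlDr; apply: lb_le_inf => [|_ [x _ <-]].
    exact: (Ainf _ _).1.
  rewrite lerBlDr; apply: (@le_trans _ _ (f x s + L * mdist y (j x))).
    by apply: (ge_inf (Ainf _ _).2); exists x.
  by rewrite -addrA lerD2l -mulrDr ler_wpM2l// addrC metric_triangle.
have gj x s : g (j x) s = f x s.
  apply/eqP; rewrite eq_le; apply/andP; split.
    by apply: (ge_inf (Ainf _ _).2); exists x; rewrite // mdistxx mulr0 addr0.
  apply: lb_le_inf => [|_ [x' _ <-]]; first exact: (Ainf _ _).1.
  by rewrite (le_trans (fs x x' s))// lerD2l ler_wpM2l.
have gdist y y' s : `|g y s - g y' s| <= L * mdist y y'.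
  rewrite ler_norml [X in _ && X]lerBlDl gL andbT lerNl opprB lerBlDl.
  by rewrite metric_sym gL.
have gb y : bounded_function (g y).
  apply/asboolP; exists (L * mdist y (j point) + `|f point|) => s.
  rewrite -[g y s](subrK (g (j point) s)) (le_trans (ler_normD _ _))// lerD//.
  by rewrite gj; exact: supnorm_ub.
exists (fun y => Linfty (gb y)) => [x|y y'].
  by apply/val_inj/funext => s; exact: gj.
by apply: supnorm_le => [|s]; [rewrite mulr_ge0// mdist_ge0|exact: gdist].
Qed.

Section CanonicalEmbedding.
Context {R : realType} (E : completeNormedModType R).

Let ev (x : E) (s : unit_ball (dual E)) : R := (val s : blin E R) x.

Let ev_le x s : `|ev x s| <= `|x|.
Proof.
have s1 : `|val s : dual E| < 1 := set_mem (valP s).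
by rewrite (le_trans (blin_ub (val s) x))// ler_piMl// ltW.
Qed.

Let ev_bounded x : bounded_function (ev x).
Proof. by apply/asboolP; exists `|x|; exact: ev_le. Qed.

Let embed_fun (x : E) : linfty_dual_ball E := Linfty (ev_bounded x).

Let embed_linear : linear embed_fun.
Proof.
by move=> a x y; apply/val_inj/funext => s; exact: (blin_linear (val s)).
Qed.

Let embed_le x : `|embed_fun x| <= 1 * `|x|.
Proof. by rewrite mul1r; apply: supnorm_le => // s; exact: ev_le. Qed.

Definition dual_ball_embedding : blin E (linfty_dual_ball E) :=
  BLin (bounded_linearP embed_linear embed_le).

Lemma dual_ball_embedding_norm_le : `|dual_ball_embedding| <= 1.
Proof. by apply: blin_le => // x; exact: embed_le. Qed.

(** The ball is open, so a norming functional may lie outside it. Scaled by [r / |x|], with [r]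
    strictly between a supposedly smaller norm and [|x|], it enters the ball and takes the value [r]
    at [x], a contradiction. *)
Lemma dual_ball_embedding_isometry x : `|dual_ball_embedding x| = `|x|.
Proof.
apply/eqP; rewrite eq_le (le_trans (embed_le x)) ?mul1r//=.
rewrite leNgt; apply/negP => lt_x.
have x0 : 0 < `|x| by exact: le_lt_trans lt_x.
have [y y1 yx] := norming_functional x.
have [mid_gt mid_lt] := midf_lt lt_x.
set r := (_ + _) / 2 in mid_gt mid_lt.
have r0 : 0 <= r by rewrite divr_ge0// addr_ge0.
have ry : unit_ball (dual E) ((r / `|x|) *: y).
  rewrite /unit_ball/= normrZ ger0_norm ?divr_ge0//.
  rewrite (le_lt_trans (ler_piMr _ y1)) ?divr_ge0//.
  by rewrite ltr_pdivrMr// mul1r.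
pose s : unit_ball (dual E) := SigSub (mem_set ry).
have sx : ev x s = r by rewrite -[LHS]/((r / `|x|) * y x) yx divfK// gt_eqF.
have := supnorm_ub (embed_fun x) s; rewrite -[embed_fun x s]/(ev x s) sx.
by rewrite ger0_norm// leNgt mid_gt.
Qed.

End CanonicalEmbedding.


(** * Linearization of the factorization *)

Theorem proposition3 (R : realType) (E F : completeNormedModType R)
    (T : blin E (dual F)) (I : banach_lip_ideal R)
    (Imax : maximal_ideal I) (Itrans : translation_invariant I)
    (f : normed_metric E -> normed_metric (linfty_dual_ball E))
    (g : normed_metric (linfty_dual_ball E) -> dual F)
    (flip : is_lipschitz f) (gI : ideal_mem I g)
    (Tgf : (T : E -> dual F) = g \o f) :
  exists (S : blin E (linfty_dual_ball E))
         (U : blin (linfty_dual_ball E) (dual F)),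
    [/\ ideal_lin I U,
        (T : E -> dual F) = U \o S &
        ideal_lin_norm I U * `|S| <= Lip f * ideal_norm I g].
Proof.
pose Z := linfty_dual_ball E; pose j := dual_ball_embedding E.
have [L0 fL] := Lip_bound flip; set L := Lip f in L0 fL *.
have TE e : T e = g (f e) by rewrite Tgf.
(* [f] need not fix 0: replace it by [f - f0] and [g] by its translate at [f0]. The composite is
   still [T], because [g f0 = T 0 = 0]. *)
pose f0 : Z := f (0 : E).
have g0 : g f0 = 0 by rewrite -TE linear0.
have [] := translation_mem f0 Itrans gI.
set g1 := (X in ideal_mem I X) => g1I g1n.
have [||ft ftj ftL] := @mcshane R (normed_metric E) (normed_metric Z) _ j
    (fun e => (f e : Z) - f0) L _ L0.
- move=> x x'; rewrite [leRHS]normed_mdistE -linearB.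
  by rewrite dual_ball_embedding_isometry.
- by move=> x x'; rewrite opprD addrACA subrr addr0; exact: fL.
have ft0 : ft 0 = 0.
  by have := ftj (0 : E); rewrite linear0 => ->; rewrite subrr.
have [hI hn] := ideal_precomp (g := ft : normed_metric Z -> normed_metric Z)
  (conj L0 ftL) ft0 g1I.
set h := g1 \o _ in hI hn.
have hj e : h (j e) = T e.
  by rewrite /h/= ftj /g1 subrK g0 subr0 TE.
(* Average over [E]: on [j(E)] the map [h] agrees with the additive [T], so its values there
   survive. *)
have [h1 [h1I h1n h1D h1E]] := ideal_invariant_average j Imax Itrans hI.
have h1j e : h1 (j e) = T e.
  rewrite h1E => [|d]; first exact: hj.
  by rewrite -linearD !hj linearD addrK.
(* Average over [Z]: additivity of [h1] along [j(E)] makes all its translates agree at [j e], so the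
   values there survive again. *)
have [h2 [h2I h2n h2D h2E]] :=
  ideal_invariant_average (idfun : Z -> Z) Imax Itrans h1I.
have h2j e : h2 (j e) = T e.
  rewrite h2E => [|d]; first exact: h1j.
  by rewrite /= [j e + d]addrC h1D addrAC subrr add0r.
have h20 : h2 0 = 0 by have [_ ->] := ideal_Lip0 h2I.
have h2_le (z : Z) : `|h2 z| <= ideal_norm I h2 * `|z|.
  have := ideal_dist_le h2I (lexx _) (z : normed_metric Z) (0 : Z).
  by rewrite h20 subr0 normed_mdistE subr0.
have h2l : linear (h2 : Z -> dual F) := additive_bounded_linear h2D h2_le.
exists j, (BLin (bounded_linearP h2l h2_le)); split => //.
  by apply/funext => e; rewrite /= h2j.
have h2_ge0 := ideal_norm_ge0 h2I.
rewrite (le_trans (ler_piMr h2_ge0 (dual_ball_embedding_norm_le E)))//.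
rewrite (le_trans h2n)// (le_trans h1n)// (le_trans hn)//.
by rewrite ler_wpM2l.
Qed.
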